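(* The principle $\diamondsuit(\mathfrak r_P)$ implies that there exists a gruff ultrafilter on $\mathbb Q$.
   Context: $\mathbb Q$ and $\mathbb Q^+$ (positive rationals) carry the Euclidean subspace topology. A set is crowded if it has no isolated points, perfect if closed and crowded. A nonprincipal ultrafilter on $\mathbb Q$ is gruff if for every $A\in u$ there is a perfect $X\in u$ with $X\subseteq A$. A set $X\subseteq\mathbb Q^+$ is two-sided crowded if for every $x\in X$ and $\varepsilon>0$ there are $y,z\in X$ with $x-\varepsilon<y<x<z<x+\varepsilon$, and two-sided perfect if moreover closed in $\mathbb Q^+$. Let $\mathscr B$ be the family of two-sided perfect subsets of $\mathbb Q^+$ unbounded above, and $\mathscr P'$ the family of subsets of $\mathbb Q^+$ containing a member of $\mathscr B$. For $Y\subseteq\mathbb Q^+$ and $X\in\mathscr B$, say $X$ reaps $Y$ modulo $\mathscr P'$ if $X\setminus Y\notin\mathscr P'$ or $X\cap Y\notin\mathscr P'$. Identify $\mathcal P(\mathbb Q^+)$ with the Cantor space $2^{\mathbb Q^+}$, and each $2^\alpha$ ($\alpha<\omega_1$) with a Cantor space; a function $F:2^{<\omega_1}\to\mathcal P(\mathbb Q^+)$ is Borel if its restriction to each $2^\alpha$, $\alpha<\omega_1$, is Borel. $\diamondsuit(\mathfrak r_P)$ is the statement: for every Borel $F:2^{<\omega_1}\to\mathcal P(\mathbb Q^+)$ there is $g:\omega_1\to\mathscr B$ such that for every $f:\omega_1\to 2$, the set $\{\alpha<\omega_1: g(\alpha)\text{ reaps }F(f\restriction\alpha)\text{ modulo }\mathscr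 P'\}$ is stationary in $\omega_1$. *)

(* Defs.v *)
From HB Require Import structures.
From mathcomp Require Import all_boot all_order all_algebra.
From mathcomp Require Import all_classical all_reals all_analysis.
From mathcomp Require Import wochoice.

Set Implicit Arguments.
Unset Strict Implicit.
Unset Printing Implicit Defensive.

Import Order.TTheory GRing.Theory Num.Theory.

Local Open Scope classical_set_scope.
Local Open Scope ring_scope.

(* [rat^o] carries the topology of the metric |x - y|, which is the topology
   that Q inherits from the real line. *)
HB.instance Definition _ := PseudoMetric.copy rat rat^o.

Definition crowded (T : topologicalType) (X : set T) : Prop :=
  isolated X = set0.

(* Stated with the absence of isolated points; [perfectP] relates it to the
   library's [perfect_set], which reads [closed X /\ limit_point X = X]. *)
Definition perfect (T : topologicalType) (X : set T) : Prop :=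
  closed X /\ crowded X.

Definition nonprincipal (T : Type) (u : set_system T) : Prop :=
  forall x, u <> principal_filter x.

Definition gruff (u : set_system rat) : Prop :=
  [/\ UltraFilter u,
      nonprincipal u &
      forall A, u A -> exists X, [/\ u X, perfect X & X `<=` A]].

(* A subtype, with the subspace topology: [closed] on subsets of [ratp] means
   closed in the positive rationals. *)
Definition ratp : Type := set_type [set q : rat | 0 < q].
HB.instance Definition _ := Topological.on ratp.

Definition two_sided_crowded (X : set ratp) : Prop :=
  forall x, X x -> forall e : rat, 0 < e ->
    exists y z, [/\ X y, X z &
      [/\ val x - e < val y, val y < val x, val x < val z
        & val z < val x + e]].

Definition two_sided_perfect (X : set ratp) : Prop :=
  closed X /\ two_sided_crowded X.

Definition unbounded_above (X : set ratp) : Prop :=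
  forall M : rat, exists2 x, X x & M < val x.

Definition scrB : set (set ratp) :=
  [set X | two_sided_perfect X /\ unbounded_above X].

Definition scrP' : set (set ratp) :=
  [set A | exists2 X, scrB X & X `<=` A].

Definition reaps (X Y : set ratp) : Prop :=
  ~ scrP' (X `\` Y) \/ ~ scrP' (X `&` Y).

Section ordinals.
Context {d : Order.disp_t}.
Local Open Scope order_scope.

(* The order type omega_1, up to isomorphism. *)
Definition is_omega1 (W : orderType d) : Prop :=
  [/\ well_order (<=%O : rel W),
      ~ countable [set: W] &
      forall a : W, countable [set b : W | b < a]].

Definition unbounded (W : orderType d) (C : set W) : Prop :=
  forall a, exists2 c, C c & a < c.

(* [C] contains every nonzero [a] below which it is cofinal; the second
   condition makes such an [a] a limit. *)
Definition club_closed (W : orderType d) (C : set W) : Prop :=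
  forall a : W, (exists b, b < a) ->
    (forall b, b < a -> exists2 c, C c & b < c < a) -> C a.

Definition club (W : orderType d) (C : set W) : Prop :=
  club_closed C /\ unbounded C.

Definition stationary (W : orderType d) (S : set W) : Prop :=
  forall C, club C -> (S `&` C) !=set0.

(* The ordinal [a], as the set of its predecessors. *)
Definition pred_of (W : orderType d) (a : W) : Type := {b : W | b < a}.

Definition restr (W : orderType d) (f : W -> bool) (a : W) :
  pred_of a -> bool := fun b => f (val b).

End ordinals.
Arguments restr {d W} f a b.

Definition borel_fun (T U : topologicalType) (f : T -> U) : Prop :=
  forall B : set U, <<s open >> B -> <<s open >> (f @^-1` B).

(* Identification of P(I) with 2^I. *)
Definition indic_bool (I : Type) (A : set I) : {ptws I -> bool} :=
  fun i => i \in A.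

Definition borel_on_levels (d : Order.disp_t) (W : orderType d)
    (F : forall a : W, (pred_of a -> bool) -> set ratp) : Prop :=
  forall a : W,
    borel_fun (fun s : {ptws pred_of a -> bool} => indic_bool (F a s)).

Definition diamond_rP (d : Order.disp_t) (W : orderType d) : Prop :=
  forall F : (forall a : W, (pred_of a -> bool) -> set ratp),
    borel_on_levels F ->
    exists g : W -> set ratp, (forall a, scrB (g a)) /\
      forall f : W -> bool,
        stationary [set a | reaps (g a) (F a (restr f a))].

Section omega1_model.
Local Open Scope order_scope.

(* A realization of omega_1: the elements with countably many predecessors in
   a well-order of [set nat]. *)
Definition wo_le : rel (set nat) := sval (well_ordering_principle (set nat)).

Lemma wo_leP : well_order wo_le.
Proof. exact: (svalP (well_ordering_principle (set nat))). Qed.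

Lemma wo_le_total : total wo_le.
Proof.
by move=> x y; apply: (wo_chainW (C := predT)) => // A _; exact: wo_leP.
Qed.

Lemma wo_le_anti : antisymmetric wo_le.
Proof.
move=> x y; apply: (wo_chain_antisymmetric (C := predT)) => // A _.
exact: wo_leP.
Qed.

Lemma wo_le_trans : transitive wo_le.
Proof.
move=> y x z xy yz.
have [|m [[+ lbm] _]] := @wo_leP (mem [:: x; y; z]); first by exists x; rewrite inE eqxx.
have mx : wo_le m x by apply: lbm; rewrite !inE eqxx.
have my : wo_le m y by apply: lbm; rewrite !inE eqxx orbT.
have mz : wo_le m z by apply: lbm; rewrite !inE eqxx !orbT.
rewrite !inE => /or3P[] /eqP e; rewrite e in mx my mz => //.
- by rewrite (@wo_le_anti x y) // xy mx.
- by rewrite -(@wo_le_anti y z) // yz my.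
Qed.

Definition omega1 : Type :=
  {x : set nat | `[< countable [set y | wo_le y x && (y != x)] >]}.
HB.instance Definition _ := Choice.on omega1.

Definition omega1_le (x y : omega1) : bool := wo_le (val x) (val y).

Lemma omega1_le_refl : reflexive omega1_le.
Proof. by move=> x; have := wo_le_total (val x) (val x); rewrite orbb. Qed.

Lemma omega1_le_anti : antisymmetric omega1_le.
Proof. by move=> x y /wo_le_anti/val_inj. Qed.

Lemma omega1_le_trans : transitive omega1_le.
Proof. by move=> y x z; exact: wo_le_trans. Qed.

Lemma omega1_le_total : total omega1_le.
Proof. by move=> x y; exact: wo_le_total. Qed.

Fact omega1_display : Order.disp_t. Proof. exact: Order.Disp tt tt. Qed.

HB.instance Definition _ := Order.Le_isPOrder.Build omega1_display omega1
  omega1_le_refl omega1_le_anti omega1_le_trans.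
HB.instance Definition _ :=
  Order.POrder_isTotal.Build omega1_display omega1 omega1_le_total.

Lemma uncountable_set_nat : ~ countable [set: set nat].
Proof.
move=> /countable_injP[f /in2TT finj].
pose D : set nat := [set n | exists2 A, f A = n & ~ A n].
have DfD : ~ D (f D) by move=> DfD; have [A /finj ->] := DfD.
by apply: (DfD); exists D.
Qed.

Lemma omega1P : is_omega1 omega1.
Proof.
have ltW (x y : set nat) : ~~ wo_le x y -> wo_le y x.
  by have /orP[->//|->] := wo_le_total x y.
have inj_val (S : set omega1) : countable (val @` S) -> countable S.
  move=> /countable_injP[f finj]; apply/countable_injP.
  exists (f \o val) => x y xS yS /= fxy.
  apply: val_inj; apply: finj => //; apply/mem_set.
    by exists x => //; exact/set_mem.
  by exists y => //; exact/set_mem.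
split.
- apply: antisymmetric_well_order; first exact: le_anti.
  move=> A [a Aa].
  have [|m [[/asboolP[b Ab <-] lbm] _]] :=
      @wo_leP [pred x | `[< exists2 b : omega1, b \in A & val b = x >]].
    by exists (val a); apply/asboolP; exists a.
  exists b; split=> // c Ac; apply: lbm; apply/asboolP.
  by exists c.
- move=> cW.
  have cI : countable (val @` [set: omega1]).
    by apply: sub_countable cW; exact: card_image_le.
  have [|m [[+ lbm] _]] :=
      @wo_leP [pred x | `[< ~ countable [set y | wo_le y x && (y != x)] >]].
    apply: contrapT => /forallNP h; apply: uncountable_set_nat.
    apply: sub_countable cI; apply: subset_card_le => x _.
    have xP : `[< countable [set y | wo_le y x && (y != x)] >].
      by apply/asboolP; apply: contrapT => nx; apply: (h x); apply/asboolP.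
    by exists (Sub x xP : omega1).
  move=> /asboolP; apply.
  apply: sub_countable cI; apply: subset_card_le => y /= /andP[ym ynm].
  have yP : `[< countable [set z | wo_le z y && (z != y)] >].
    apply/asboolP; apply: contrapT => ny; move/eqP: ynm; apply.
    by apply: wo_le_anti; rewrite ym lbm//; apply/asboolP.
  by exists (Sub y yP : omega1).
- move=> a; apply: inj_val; have /asboolP := valP a; apply: sub_countable.
  apply: subset_card_le => y [b /=]; rewrite lt_neqAle => /andP[ba ab] <- /=.
  by apply/andP; split; [exact: ab|exact: ba].
Qed.

End omega1_model.

(* Main.v *)
Require Import Defs.
From mathcomp Require Import all_boot all_order all_algebra zify ring lra.
From mathcomp Require Import all_classical all_reals all_analysis.
From mathcomp Require Import wochoice.

(* The positive rationals are arranged in a tree of finite sequences in which the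
   children of a node converge to it, alternately from its left and from its
   right, and the columns (the subtrees above the root) tend to infinity. The
   embeddings of the tree into itself carry sets of B to sets of B, and a set
   that contains no member of B becomes thin after deleting finitely many columns:
   no nonempty part of it is two-sided crowded.

   Diamond, transported to functions on sequences of reals, is used three
   times. First it produces a decreasing tower of subsets of N generating an
   ultrafilter w. Next it turns into a domination principle: if X reaps
   the set of points to the left of their last ancestor in a locally finite set D,
   then D meets X in finitely many columns only. This lets a level of the tower,
   which only knows the earlier levels, choose numbers in prescribed sets of w and
   finite sets containing prescribed ordinals. Finally, a decreasing tower of
   copies X_a of the tree is built by recursion. At level a the columns of a
   pseudo-intersection of the previous copies are refined by an embedding which
   guides every point out of a thin set: rank analysis of a thin set N shows that
   steps typical for w lead out of N, along which ordinal ranks decrease, so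
   the guessed choices and ranks suffice to perform the search without knowing N.
   Given a set Y, some X_a reaps it, which makes Y or its complement thin in X_a
   and in all later copies, and a later copy avoids the thin set modulo finitely
   many columns. So the X_a generate an ultrafilter modulo finitely many columns,
   and it is gruff since deleting finitely many columns leaves a perfect set. *)

Set Implicit Arguments.
Unset Strict Implicit.
Unset Printing Implicit Defensive.

Import Order.TTheory GRing.Theory Num.Theory.

Local Open Scope classical_set_scope.

Definition inf_often (P : nat -> Prop) : Prop :=
  forall k, exists2 j, k <= j & P j.

Lemma inf_oftenS (P Q : nat -> Prop) :
  (forall j, P j -> Q j) -> inf_often P -> inf_often Q.
Proof. by move=> PQ iP k; have [j kj Pj] := iP k; exists j => //; exact: PQ. Qed.

Lemma not_inf_often (P : nat -> Prop) :
  ~ inf_often P -> exists k, forall j, k <= j -> ~ P j.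
Proof.
move=> /existsNP[k nk]; exists k => j kj Pj; apply: nk; by exists j.
Qed.

Lemma inj_unbounded (f : nat -> nat) : injective f ->
  forall k, exists l, forall m, l <= m -> k <= f m.
Proof.
move=> fi; elim=> [|k [l IH]]; first by exists 0.
have [[m fm]|nm] := pselect (exists m, f m = k).
  exists (maxn l m.+1) => j; rewrite geq_max => /andP[lj mj].
  rewrite ltn_neqAle IH // andbT; apply/eqP => kj.
  by move: mj; rewrite (fi j m) ?ltnn // -kj.
exists l => m lm; rewrite ltn_neqAle IH // andbT; apply/eqP => km.
by apply: nm; exists m.
Qed.

Lemma inf_often_inj (f : nat -> nat) (P : nat -> Prop) : injective f ->
  inf_often (fun m => P (f m)) -> inf_often P.
Proof.
move=> fi iP k; have [l lP] := inj_unbounded fi k.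
by have [j lj Pj] := iP l; exists (f j) => //; exact: lP.
Qed.

Lemma inf_often_enum (P : nat -> Prop) : inf_often P ->
  exists f : nat -> nat, {homo f : m n / m < n} /\ forall n, P (f n).
Proof.
move=> iP.
have /choice[g gP] : forall k, exists j, k <= j /\ P j.
  by move=> k; have [j] := iP k; exists j.
pose f := fix f n := if n is m.+1 then g (f m).+1 else g 0.
exists f; split; last by case=> [|n] /=; apply: (gP _).2.
apply: (@homo_ltn nat f (fun m n => m < n)) => [y x z|n]; first exact: ltn_trans.
exact: (gP _).1.
Qed.

(** * The tree of finite sequences *)

(* A point is a nonempty sequence, written backwards: the children of [s] are
   the [m :: s], those with [m] even lying to its left and those with [m] odd
   to its right, and [m :: s] tends to [s] when [m] tends to infinity. *)

Definition meets (A : set (seq nat)) (s : seq nat) : Prop :=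
  exists2 t, A t & suffix s t.

Definition closedT (C : set (seq nat)) : Prop :=
  forall s, s <> [::] -> ~ C s ->
    exists k, forall m, k <= m -> ~ meets C (m :: s).

Definition crowdedT (C : set (seq nat)) : Prop :=
  forall s, C s -> forall b, inf_often (fun m => odd m = b /\ meets C (m :: s)).

Definition unboundedT (C : set (seq nat)) : Prop :=
  inf_often (fun n => meets C [:: n]).

Definition perfT (C : set (seq nat)) : Prop :=
  [/\ ~ C [::], closedT C, crowdedT C & unboundedT C].

Definition posT (A : set (seq nat)) : Prop := exists2 C, perfT C & C `<=` A.

Definition reapsT (X Y : set (seq nat)) : Prop :=
  ~ posT (X `\` Y) \/ ~ posT (X `&` Y).

Lemma posTS (A B : set (seq nat)) : A `<=` B -> posT A -> posT B.
Proof. by move=> AB [C pC CA]; exists C => //; exact: subset_trans AB. Qed.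

Lemma meetsS (A B : set (seq nat)) s : A `<=` B -> meets A s -> meets B s.
Proof. by move=> AB [t At st]; exists t => //; exact: AB. Qed.

Lemma meets_suffix (A : set (seq nat)) s t : suffix s t -> meets A t -> meets A s.
Proof. by move=> st [u Au tu]; exists u => //; exact: suffix_trans tu. Qed.

Lemma suffix_cons_inj (i j : nat) s t :
  suffix (i :: s) t -> suffix (j :: s) t -> i = j.
Proof.
move=> /suffixP[u ->] /suffixP[v].
rewrite -!cat_rcons => /(congr1 (fun x => rev x)); rewrite !rev_cat.
by move=> /eqP; rewrite eqseq_cat // eqxx /= !rev_rcons => /eqP[].
Qed.

Lemma suffix_consW (i : nat) s t : suffix (i :: s) t -> suffix s t.
Proof. by apply: suffix_trans; exact: suffix_suffix [:: i] s. Qed.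

Lemma suffix_cons_irr (i : nat) s t : suffix (i :: s) t -> ~~ suffix t s.
Proof.
move=> /size_suffix /= st; apply/negP => /size_suffix ts.
by move: (leq_trans st ts); rewrite ltnn.
Qed.

Variant diverge (s t : seq nat) : Prop :=
  | Div_ext i of suffix (i :: t) s
  | Div_split r i j of i <> j & suffix (i :: r) s & suffix (j :: r) t.

Lemma not_suffix s t : ~~ suffix s t -> diverge s t.
Proof.
elim: s => [|x s IH]; first by rewrite suffix0s.
move=> xst; have [/suffixP[v tE]|/IH[i st|r i j ij si tj]] := boolP (suffix s t).
- case/lastP: v tE => [|v j] tE; first by apply: (@Div_ext _ _ x); rewrite tE suffix_refl.
  apply: (@Div_split _ _ s x j); rewrite ?suffix_refl //.
    by move=> xj; move/negP: xst; apply; rewrite tE xj cat_rcons suffix_suffix.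
  by rewrite tE cat_rcons suffix_suffix.
- apply: (@Div_ext _ _ i); apply: suffix_trans st _; exact: suffix_suffix [:: x] s.
- apply: (@Div_split _ _ r i j) => //; apply: suffix_trans si _.
  exact: suffix_suffix [:: x] s.
Qed.

Lemma suffix_cmp (r s t : seq nat) : suffix r t -> suffix s t ->
  suffix r s \/ exists i, suffix (i :: s) r.
Proof.
move=> rt st; have [|/not_suffix[i ri|q i j ij ri sj]] := boolP (suffix r s).
- by left.
- by right; exists i.
- by case: ij; apply: (@suffix_cons_inj i j q t); [exact: suffix_trans rt|exact: suffix_trans st].
Qed.

Lemma split_uniq (r s x y : seq nat) i j k l : i <> j -> k <> l ->
  suffix (i :: r) x -> suffix (j :: r) y ->
  suffix (k :: s) x -> suffix (l :: s) y -> r = s.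
Proof.
move=> ij kl ix jy kx ly.
have key a b c d (p q : seq nat) n : a <> b -> suffix (a :: p) x -> suffix (b :: p) y ->
    suffix (c :: q) x -> suffix (d :: q) y -> suffix (n :: p) q -> False.
  move=> ab ax byy cx dy npq; apply: ab.
  have na : n = a by apply: suffix_cons_inj ax; apply: suffix_trans npq _; exact: suffix_consW cx.
  rewrite -na; apply: suffix_cons_inj byy; apply: suffix_trans npq _; exact: suffix_consW dy.
have [rs|[n sr]] := suffix_cmp (suffix_consW ix) (suffix_consW kx); last first.
  by case: (key _ _ _ _ _ _ _ kl kx ly ix jy sr).
have [sr|[n nrs]] := suffix_cmp (suffix_consW kx) (suffix_consW ix); last first.
  by case: (key _ _ _ _ _ _ _ ij ix jy kx ly nrs).
apply/eqP; move: rs => /suffixP[u su]; move: sr => /suffixP[v rv].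
have : size u = 0.
  by have := congr1 size su; have := congr1 size rv; rewrite !size_cat; lia.
by move=> /size0nil u0; rewrite su u0.
Qed.

(** * Embeddings of the tree *)

Definition emb (e : seq nat -> seq nat) : Prop :=
  e [::] = [::] /\ exists kap : seq nat -> nat -> nat,
  [/\ forall s, injective (kap s),
      forall s m, s <> [::] -> odd (kap s m) = odd m &
      forall s m, suffix (kap s m :: e s) (e (m :: s))].

Section Emb.
Variables (e : seq nat -> seq nat).
Hypothesis emb_e : emb e.

Lemma emb_suffix s t : suffix s t -> suffix (e s) (e t).
Proof.
case: emb_e => _ [kap [_ _ ek]] /suffixP[u ->{t}].
elim: u => [|m u IH]; first exact: suffix_refl.
by apply: suffix_trans IH _; exact: suffix_consW (ek _ _).
Qed.

Lemma emb_suffix_reflect s t : suffix (e s) (e t) -> suffix s t.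
Proof.
case: emb_e => _ [kap [ki _ ek]] st.
have [//|/not_suffix[i ts|r i j ij si tj]] := boolP (suffix s t); exfalso.
  have /suffix_cons_irr/negP := suffix_trans (ek t i) (emb_suffix ts); exact.
have si' := suffix_trans (suffix_trans (ek r i) (emb_suffix si)) st.
have tj' := suffix_trans (ek r j) (emb_suffix tj).
by apply: ij; apply: (ki r); apply: suffix_cons_inj si' tj'.
Qed.

Lemma suffix_anti (s t : seq nat) : suffix s t -> suffix t s -> s = t.
Proof.
move=> /suffixP[u ->] /size_suffix; rewrite size_cat -{2}[size s]add0n leq_add2r.
by rewrite leqn0 => /eqP/size0nil ->.
Qed.

Lemma emb_inj : injective e.
Proof.
move=> s t est; apply: suffix_anti; apply: emb_suffix_reflect.
  by rewrite est suffix_refl.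
by rewrite est suffix_refl.
Qed.

Lemma emb_neq0 s : s <> [::] -> e s <> [::].
Proof.
move=> s0 es0; apply: s0; apply: emb_inj.
by case: emb_e => e0 _; rewrite e0.
Qed.

Lemma emb_meets (A : set (seq nat)) s : meets A s -> meets (e @` A) (e s).
Proof. by move=> [t At st]; exists (e t); [exists t|exact: emb_suffix]. Qed.

Lemma emb_image_perfT (g : set (seq nat)) : perfT g -> perfT (e @` g).
Proof.
case: (emb_e) => e0 [kap [ki kodd ek]] [g0 gcl gcr gunb]; split.
- move=> [t gt et]; apply: g0; suff <- : t = [::] by [].
  by apply: emb_inj; rewrite e0.
- move=> v v0 ngv; have [[s sv]|nv] := pselect (exists s, e s = v).
    have ns : s <> [::] by move=> sE; apply: v0; rewrite -sv sE e0.
    have ngs : ~ g s by move=> gs; apply: ngv; exists s.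
    have [k kP] := gcl s ns ngs.
    exists (\max_(m < k) (kap s m).+1) => j kj [_ [t gt <-]]; rewrite -sv => jt.
    have st : suffix s t by apply: emb_suffix_reflect; exact: suffix_consW jt.
    have [ts|] := boolP (suffix t s).
      by apply: ngs; rewrite (suffix_anti st ts).
    move=> /not_suffix[m mt|r a b ab ta sb]; last first.
      by apply: ab; apply: suffix_cons_inj ta _; exact: suffix_trans st.
    have jm : j = kap s m.
      apply: suffix_cons_inj jt _; apply: suffix_trans (ek s m) _.
      exact: emb_suffix.
    have [km|mk] := leqP k m; first by apply: (kP m km); exists t.
    have := leq_trans (leq_bigmax (F := fun m : 'I_k => (kap s m).+1) (Ordinal mk)) kj.
    by rewrite /= -jm ltnn.
  have uniqj i j : meets (e @` g) (i :: v) -> meets (e @` g) (j :: v) -> i = j.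
    move=> [_ [x gx <-] ix] [_ [y gy <-] jy]; apply: contrapT => ij.
    have nxy : ~~ suffix x y.
      apply/negP => xy; apply: ij.
      apply: suffix_cons_inj jy; apply: suffix_trans ix _; exact: emb_suffix.
    case: (not_suffix nxy) => [m mx|r a b ab ax byy].
      apply: ij; apply: suffix_cons_inj ix _; apply: suffix_trans jy _.
      by apply: emb_suffix; exact: suffix_consW mx.
    apply: nv; exists r; apply: (@split_uniq _ _ (e x) (e y) (kap r a) (kap r b) i j) => //.
    - by move=> /ki.
    - by apply: suffix_trans (ek _ _) _; exact: emb_suffix.
    - by apply: suffix_trans (ek _ _) _; exact: emb_suffix.
  have [[i ii]|nii] := pselect (exists i, meets (e @` g) (i :: v)).
    by exists i.+1 => m im mm; rewrite (uniqj _ _ ii mm) ltnn in im.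
  by exists 0 => m _ mm; apply: nii; exists m.
- move=> _ [s gs <-] b.
  have ns : s <> [::] by move=> sE; apply: g0; rewrite -sE.
  apply: (inf_often_inj (ki s)); apply: inf_oftenS (gcr s gs b) => m [mb gm].
  split; first by rewrite kodd.
  by apply: (meets_suffix (ek s m)); exact: emb_meets.
- apply: (inf_often_inj (ki [::])); apply: inf_oftenS gunb => n gn.
  have := ek [::] n; rewrite {1}e0 => en; apply: (meets_suffix en); exact: emb_meets.
Qed.

Lemma emb_preimage_perfT (C : set (seq nat)) :
  perfT C -> C `<=` range e -> perfT (e @^-1` C).
Proof.
case: (emb_e) => e0 [kap [ki kodd ek]] [C0 Ccl Ccr Cunb] Ce.
have pull s j : meets C (j :: e s) -> exists m, j = kap s m /\ meets (e @^-1` C) (m :: s).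
  move=> [c Cc jc]; have [t _ tc] := Ce c Cc; rewrite -{}tc in jc Cc.
  have nts : ~~ suffix t s.
    apply/negP => /emb_suffix ts; have /negP := suffix_cons_irr jc; exact.
  have st : suffix s t by apply: emb_suffix_reflect; exact: suffix_consW jc.
  case: (not_suffix nts) => [m mt|r a b ab ta sb]; last first.
    by case: ab; apply: suffix_cons_inj ta _; exact: suffix_trans st.
  exists m; split; last by exists t.
  apply: suffix_cons_inj jc _; apply: suffix_trans (ek s m) _; exact: emb_suffix.
have pullio s (Q : nat -> Prop) : inf_often (fun j => Q j /\ meets C (j :: e s)) ->
    inf_often (fun m => Q (kap s m) /\ meets (e @^-1` C) (m :: s)).
  move=> iC k.
  have [j kj [Qj mj]] := iC (\max_(m < k) (kap s m).+1).
  have [m [jm mm]] := pull s j mj; exists m; last by rewrite -jm.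
  rewrite leqNgt; apply/negP => mk.
  have := leq_trans (leq_bigmax (F := fun m : 'I_k => (kap s m).+1) (Ordinal mk)) kj.
  by rewrite /= -jm ltnn.
split.
- by rewrite /= e0.
- move=> s s0 ns; have [k kP] := Ccl (e s) (emb_neq0 s0) ns.
  have [l lP] := inj_unbounded (ki s) k.
  exists l => m lm [t Ct mt]; apply: (kP _ (lP _ lm)); exists (e t) => //.
  by apply: suffix_trans (ek s m) _; exact: emb_suffix.
- move=> s Cs b; have s0 : s <> [::] by move=> sE; apply: C0; rewrite -e0 -sE.
  by apply: inf_oftenS (pullio s (fun j => odd j = b) (Ccr _ Cs b)) => m [+ mm]; rewrite kodd.
- have := pullio [::] (fun=> True); rewrite e0 => H.
  by apply: inf_oftenS (H _) => [m []//|]; apply: inf_oftenS Cunb.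
Qed.

End Emb.

Lemma emb_comp e f : emb e -> emb f -> emb (e \o f).
Proof.
move=> ee ef; case: (ee) => e0 [kap [ki ko ek]]; case: (ef) => f0 [lam [li lo fl]].
split; first by rewrite /= f0.
exists (fun s m => kap (f s) (lam s m)); split.
- by move=> s m n /ki /li.
- by move=> s m s0; rewrite ko ?lo //; exact: emb_neq0.
- move=> s m /=; apply: suffix_trans (ek _ _) _; exact: emb_suffix.
Qed.

Lemma crowded_emb (A : set (seq nat)) : ~ A [::] -> crowdedT A -> unboundedT A ->
  exists2 e, emb e & forall s, s <> [::] -> A (e s).
Proof.
move=> A0 Acr Aunb.
have step x : exists p : (nat -> nat) * (nat -> seq nat), x = [::] \/ A x ->
    [/\ injective p.1, x <> [::] -> forall m, odd (p.1 m) = odd m,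
        forall m, A (p.2 m) & forall m, suffix (p.1 m :: x) (p.2 m)].
  have [xP|] := pselect (x = [::] \/ A x); last by exists (id, fun=> [::]).
  have [k [ki ko kA]] : exists k : nat -> nat, [/\ injective k,
      x <> [::] -> forall m, odd (k m) = odd m & forall m, meets A (k m :: x)].
    case: xP => [->|Ax].
      have [k [kmon kA]] := inf_often_enum Aunb; exists k; split => //.
      move=> m n; case: (ltngtP m n) => // /kmon; by [move=> + E; rewrite E ltnn].
    have /choice[k kP] : forall b : bool, exists k : nat -> nat,
        {homo k : m n / m < n} /\ forall n, odd (k n) = b /\ meets A (k n :: x).
      by move=> b; exact: inf_often_enum (Acr x Ax b).
    have ki b : injective (k b).
      move=> m n; case: (ltngtP m n) => // /(kP b).1; by [move=> + E; rewrite E ltnn].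
    exists (fun m => k (odd m) m./2); split.
    - move=> m n mn; have omn : odd m = odd n.
        by rewrite -((kP (odd m)).2 m./2).1 mn ((kP (odd n)).2 n./2).1.
      by move: mn; rewrite omn => /ki hmn; rewrite -(odd_double_half m) omn hmn odd_double_half.
    - by move=> _ m; exact: ((kP (odd m)).2 m./2).1.
    - by move=> m; exact: ((kP (odd m)).2 m./2).2.
  have /choice[t tP] : forall m, exists t, A t /\ suffix (k m :: x) t.
    by move=> m; have [t At kt] := kA m; exists t.
  exists (k, t) => _; split=> // m; [exact: (tP m).1|exact: (tP m).2].
have /choice[p pP] := step.
pose e := fix e s := if s is m :: s' then (p (e s')).2 m else [::].
have eP s : e s = [::] \/ A (e s).
  by elim: s => [|m s IH] /=; [left|right; case: (pP _ IH)].
exists e; last first.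
  by case=> // m s _ /=; case: (pP _ (eP s)).
have e0 s : e s = [::] -> s = [::].
  by case: s => // m s /= es; case: A0; rewrite -es; case: (pP _ (eP s)).
split=> //; exists (fun s => (p (e s)).1); split=> [s|s m s0|s m].
- by case: (pP _ (eP s)).
- by case: (pP _ (eP s)) => _ /(_ _ m) -> // /e0.
- by case: (pP _ (eP s)).
Qed.

Lemma perfT_full : perfT [set s : seq nat | s <> [::]].
Proof.
split; first by [].
- by move=> s s0 [].
- move=> s _ b k; exists (k.*2 + b); last split.
  + by rewrite -addnn -addnA leq_addr.
  + by rewrite oddD odd_double oddb.
  + by exists ((k.*2 + b) :: s); rewrite ?suffix_refl.
- by move=> k; exists k => //; exists [:: k]; rewrite ?suffix_refl.
Qed.

Lemma crowded_posT (A : set (seq nat)) :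
  ~ A [::] -> crowdedT A -> unboundedT A -> posT A.
Proof.
move=> A0 Acr Aunb; have [e ee eA] := crowded_emb A0 Acr Aunb.
exists (e @` [set s : seq nat | s <> [::]]); last by move=> _ [s s0 <-]; exact: eA.
exact: emb_image_perfT perfT_full.
Qed.

Definition colT (s : seq nat) : nat := last 0 s.

Lemma colT_suffix s t : s <> [::] -> suffix s t -> colT t = colT s.
Proof. by case: s => // a s _ /suffixP[u ->]; rewrite /colT last_cat. Qed.

Lemma suffix_colT s : s <> [::] -> suffix [:: colT s] s.
Proof.
case/lastP: s => // s n _; rewrite /colT last_rcons -cats1; exact: suffix_suffix.
Qed.

Lemma perfT_cones (g : set (seq nat)) (P : nat -> Prop) (x : nat -> seq nat) :
  perfT g -> inf_often P ->
  (forall n, P n -> [/\ x n <> [::], colT (x n) = n & meets g (x n)]) ->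
  perfT [set s | g s /\ exists2 n, P n & suffix (x n) s].
Proof.
move=> [g0 gcl gcr gunb] iP xP; split.
- by case.
- move=> s s0 nG.
  have [[n Pn xs]|ncone] := pselect (exists2 n, P n & suffix (x n) s).
    have [|k kP] := gcl s s0; first by move=> gs; apply: nG; split => //; exists n.
    by exists k => m /kP nm mG; apply: nm; apply: meetsS mG => t [].
  have uniqm m : meets [set s | g s /\ exists2 n, P n & suffix (x n) s] (m :: s) ->
      suffix (m :: s) (x (colT s)).
    move=> [t [gt [n Pn xt]] mt]; have [xn0 xcol _] := xP n Pn.
    have := colT_suffix s0 (suffix_consW mt); rewrite (colT_suffix xn0 xt) xcol => <-.
    have [xs|[i ix]] := suffix_cmp xt (suffix_consW mt).
      by case: ncone; exists n.
    by rewrite (suffix_cons_inj mt (suffix_trans ix xt)).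
  have [[i ix]|ni] := pselect (exists i, suffix (i :: s) (x (colT s))).
    by exists i.+1 => m im /uniqm mx; rewrite (suffix_cons_inj ix mx) ltnn in im.
  by exists 0 => m _ /uniqm mx; apply: ni; exists m.
- move=> s [gs [n Pn xs]] b; apply: inf_oftenS (gcr s gs b) => m [mb [t gt mt]].
  split=> //; exists t => //; split=> //; exists n => //.
  by apply: suffix_trans xs _; exact: suffix_consW mt.
- apply: inf_oftenS iP => n Pn; have [x0 xcol [t gt xt]] := xP n Pn.
  exists t; first by split=> //; exists n.
  by rewrite -xcol; apply: suffix_trans (suffix_colT x0) _.
Qed.

Lemma perfT_cols (g : set (seq nat)) (P : nat -> Prop) : perfT g ->
  inf_often (fun n => P n /\ meets g [:: n]) -> perfT [set s | g s /\ P (colT s)].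
Proof.
move=> pg iP; have := perfT_cones (x := fun n => [:: n]) pg iP.
have [g0 _ _ _] := pg.
suff -> : [set s | g s /\ P (colT s)] =
    [set s | g s /\ exists2 n, P n /\ meets g [:: n] & suffix [:: n] s].
  by apply=> n [Pn gn].
apply/seteqP; split=> s [gs].
  have s0 : s <> [::] by move=> sE; apply: g0; rewrite -sE.
  move=> Ps; split=> //; exists (colT s); last exact: suffix_colT.
  by split=> //; exists s => //; exact: suffix_colT.
by move=> [n [Pn _] ns]; split=> //; rewrite (colT_suffix _ ns).
Qed.

Lemma inf_often_ge (P : nat -> Prop) k :
  inf_often P -> inf_often (fun n => k <= n /\ P n).
Proof.
move=> iP l; have [j + Pj] := iP (maxn k l); rewrite geq_max => /andP[kj lj].
by exists j.
Qed.

Lemma posT_tail (A : set (seq nat)) k :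
  posT A -> posT [set s | A s /\ k <= colT s].
Proof.
move=> [C pC CA]; exists [set s | C s /\ k <= colT s]; last by move=> s [/CA].
by apply: (perfT_cols (P := fun n => k <= n)) => //; apply: inf_often_ge; case: pC.
Qed.

Lemma not_posT_thin (A : set (seq nat)) : ~ A [::] -> ~ posT A ->
  exists k, forall D, crowdedT D -> D `<=` [set s | A s /\ k <= colT s] ->
    D `<=` set0.
Proof.
move=> A0 nA; apply: contrapT => /forallNP nk; apply: nA.
pose U := [set s | exists D, [/\ crowdedT D, D `<=` A & D s]].
have UA : U `<=` A by move=> s [D [_ DA Ds]]; exact: DA.
apply: (posTS UA).
apply: crowded_posT.
- by move/UA.
- move=> s [D [Dc DA Ds]] b; apply: inf_oftenS (Dc s Ds b) => m [mb mD].
  by split=> //; apply: meetsS mD => t Dt; exists D.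
- move=> k; have /existsNP[D] := nk k.
  move=> /not_implyP[Dc /not_implyP[DA /existsNP[s /not_implyP[Ds _]]]].
  have [As ks] := DA s Ds; exists (colT s) => //; exists s.
    by exists D; split=> // t /DA[].
  by apply: suffix_colT => sE; apply: A0; rewrite -sE.
Qed.

Definition leftof (D : set (seq nat)) : set (seq nat) :=
  [set t | exists d m, [/\ D d, suffix (m :: d) t, ~~ odd m &
    forall d', D d' -> suffix d' t -> suffix d' d]].

(* Around a common point of [g] and [D] the set [leftof D] is decided by the
   side, so that infinitely many such points would leave both halves of [g]
   positive. *)
Lemma reaps_leftof (g D : set (seq nat)) : perfT g ->
  (forall s, D s -> exists k, forall m, k <= m -> ~ meets D (m :: s)) ->
  reapsT g (leftof D) ->
  ~ inf_often (fun n => exists d, [/\ D d, g d & colT d = n]).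
Proof.
move=> pg Dd rg iP; have [g0 gcl gcr gunb] := pg.
have /choice[d dP] : forall n, exists d, (exists d, [/\ D d, g d & colT d = n]) ->
    [/\ D d, g d & colT d = n].
  move=> n; have [[d ?]|nd] := pselect (exists d, [/\ D d, g d & colT d = n]).
    by exists d.
  by exists [::] => /nd.
have half b : exists G, [/\ perfT G, G `<=` g & forall t, G t ->
    exists d m, [/\ D d, suffix (m :: d) t, odd m = b &
       forall d', D d' -> suffix d' t -> suffix d' d]].
  have /choice[m mP] : forall n, exists m, (exists d, [/\ D d, g d & colT d = n]) ->
      [/\ odd m = b, ~ meets D (m :: d n) & meets g (m :: d n)].
    move=> n; have [nd|] := pselect (exists d, [/\ D d, g d & colT d = n]); last by exists 0.
    have [Ddn gdn _] := dP n nd; have [k kP] := Dd _ Ddn.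
    by have [m km [mb mg]] := gcr _ gdn b k; exists m; split=> //; exact: kP.
  exists [set s | g s /\ exists2 n, exists d, [/\ D d, g d & colT d = n] &
     suffix (m n :: d n) s]; split.
  - apply: (perfT_cones (x := fun n => m n :: d n)) => // n nP; have [_ gdn dn] := dP n nP.
    have [_ _ mg] := mP n nP; split=> //.
    have dn0 : d n <> [::] by move=> dE; apply: g0; rewrite -dE.
    by rewrite -[RHS]dn (colT_suffix dn0 (suffix_consW (suffix_refl _))).
  - by move=> s [].
  - move=> t [gt [n nP nt]]; exists (d n), (m n); have [Dn _ _] := dP n nP.
    have [mb nD _] := mP n nP; split=> // d' Dd' d't.
    have [//|[i id']] := suffix_cmp d't (suffix_consW nt).
    case: nD; exists d' => //.
    by rewrite (suffix_cons_inj nt (suffix_trans id' d't)).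
case: rg; apply.
  have [G [pG Gg GP]] := half true; exists G => // t Gt; split; first exact: Gg.
  move=> [d' [m' [Dd' m't om' d'max]]]; have [d1 [m1 [Dd1 m1t om1 d1max]]] := GP t Gt.
  have dE : d' = d1.
    apply: suffix_anti; first by apply: d1max => //; exact: suffix_consW m't.
    by apply: d'max => //; exact: suffix_consW m1t.
  by move: om'; rewrite dE in m't; rewrite (suffix_cons_inj m't m1t) om1.
have [G [pG Gg GP]] := half false; exists G => // t Gt; split; first exact: Gg.
by have [d1 [m1 [Dd1 m1t /negbT om1 d1max]]] := GP t Gt; exists d1, m1.
Qed.

(** * The first uncountable ordinal *)

Section Omega1.
Context {d : Order.disp_t} (W : orderType d).
Hypothesis W1 : is_omega1 W.
Implicit Types a b c : W.

Lemma wo_min (P : W -> Prop) :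
  (exists a, P a) -> exists a, P a /\ forall b, P b -> (a <= b)%O.
Proof.
move=> [a0 Pa0]; case: W1 => wo _ _.
have [|m [[/asboolP Pm mmin] _]] := wo [pred x | `[< P x >]].
  by exists a0; apply/asboolP.
by exists m; split=> // b Pb; apply: mmin; apply/asboolP.
Qed.

Lemma wo_ind (P : W -> Prop) :
  (forall a, (forall b, (b < a)%O -> P b) -> P a) -> forall a, P a.
Proof.
move=> PI a; apply: contrapT => nPa.
have [m [nPm mmin]] := wo_min (ex_intro (fun x => ~ P x) a nPa).
apply: nPm; apply: PI => b bm; apply: contrapT => nPb.
by have := mmin b nPb; rewrite leNgt bm.
Qed.

Lemma wo_rec (T : Type) (F : W -> (W -> T) -> T) :
  (forall a f g, (forall b, (b < a)%O -> f b = g b) -> F a f = F a g) ->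
  T -> exists f : W -> T, forall a, f a = F a f.
Proof.
move=> FE t0.
have wf : well_founded (fun x y : W => (x < y)%O).
  by move=> a; elim/wo_ind: a => a IH; constructor => b /IH.
pose body a (r : forall b, (b < a)%O -> T) : T :=
  F a (fun b => match pselect (b < a)%O with left h => r b h | right _ => t0 end).
pose f := Fix wf (fun=> T) body.
exists f => a; rewrite /f Fix_eq.
  by apply: FE => b ba; case: pselect.
by move=> x r s rs; congr (F _ _); apply/funext => b; case: pselect.
Qed.

Lemma omega1_bound (u : nat -> W) : exists a, forall n, (u n < a)%O.
Proof.
case: W1 => _ unc ctb; apply: contrapT => /forallNP nb; apply: unc.
pose F (p : nat * bool) := if p.2 then [set u p.1] else [set b | (b < u p.1)%O].
apply: (@sub_countable _ _ _ (\bigcup_(p in [set: nat * bool]) F p)).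
  apply: subset_card_le => a _; have /existsNP[n /negP] := nb a; rewrite -leNgt.
  rewrite le_eqVlt => /orP[/eqP aE|an]; first by exists (n, true).
  by exists (n, false).
apply: bigcup_countable => [|[n []] _]; [exact: countableP|exact: countable1|exact: ctb].
Qed.

Lemma omega1_bound_countType (T : countType) (u : T -> W) :
  exists a, forall t, (u t < a)%O.
Proof.
have [[t0 _]|nt] := pselect (exists t : T, True); last first.
  have [[a _]|na] := pselect (exists a : W, True).
    by exists a => t; case: nt; exists t.
  case: W1 => _ []; suff -> : [set: W] = set0 by [].
  by rewrite -subset0 => a _; apply: na; exists a.
have [a aP] := omega1_bound (fun n => if unpickle n is Some t then u t else u t0).
by exists a => t; have := aP (pickle t); rewrite pickleK.
Qed.

Lemma omega1_inhabited : exists a : W, True.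
Proof. by have [a _] := omega1_bound_countType (fun x : void => match x with end); exists a. Qed.

Lemma pred_enum a : (exists b, (b < a)%O) ->
  exists e : nat -> W, (forall n, (e n < a)%O) /\
    forall b, (b < a)%O -> exists n, e n = b.
Proof.
move=> [b0 b0a]; case: W1 => _ _ /(_ a) /countable_injP[f finj].
have /choice[e eP] : forall n, exists b, (b < a)%O /\
    ((exists2 c, (c < a)%O & f c = n) -> f b = n).
  move=> n; have [[c ca fc]|nc] := pselect (exists2 c, (c < a)%O & f c = n).
    by exists c.
  by exists b0; split=> // /nc.
exists e; split=> [n|b ba]; first by case: (eP n).
exists (f b); apply: finj; rewrite ?inE; [by case: (eP (f b))|by []|].
by apply: (eP (f b)).2; exists b.
Qed.

Lemma ladder a : (exists b, (b < a)%O) ->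
  exists l : nat -> W, [/\ forall n, (l n < a)%O,
    {homo l : m n / m <= n >-> (m <= n)%O} &
    forall b, (b < a)%O -> exists n, (b <= l n)%O].
Proof.
move=> /pred_enum[e [ea esurj]].
pose l := fix l n := if n is m.+1 then Order.max (l m) (e n) else e 0.
exists l; split.
- by elim=> [|n IH] /=; rewrite ?gt_max ?IH ?ea.
- apply: (@homo_leq W l (fun x y => (x <= y)%O)) => [x|y x z|n] /=.
  + exact: lexx.
  + exact: le_trans.
  + by rewrite le_max lexx.
- move=> b /esurj[n <-]; exists n; case: n => [|n] /=; first exact: lexx.
  by rewrite le_max lexx orbT.
Qed.

Lemma closure_club (h : W -> W) a0 :
  club [set a | (a0 < a)%O /\ forall b, (b < a)%O -> (h b < a)%O].
Proof.
split.
  move=> a [b0 b0a] H; split.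
    by have [c [a0c _] /andP[_ ca]] := H b0 b0a; exact: lt_trans ca.
  move=> b ba; have [c [_ hc] /andP[bc ca]] := H b ba.
  exact: lt_trans (hc b bc) ca.
move=> a.
have sup (b : W) : exists c, (b < c)%O /\ forall x, (x <= b)%O -> (h x < c)%O.
  have [c0 c0P] := omega1_bound (fun=> b).
  have [e [ec esurj]] := pred_enum (ex_intro _ b (c0P 0)).
  have [c cP] := omega1_bound (fun n => if n is m.+1 then h (e m) else b).
  exists c; split; first exact: (cP 0).
  move=> x xb; have [m <-] := esurj x (le_lt_trans xb (c0P 0)).
  exact: (cP m.+1).
have /choice[g gP] := sup.
pose u := fix u n := if n is m.+1 then g (u m) else Order.max a0 a.
have [m [mP mmin]] := wo_min (omega1_bound u).
exists m; last by apply: le_lt_trans (mP 0); rewrite /= le_max lexx orbT.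
split; first by apply: le_lt_trans (mP 0); rewrite /= le_max lexx.
move=> b bm.
have [n bn] : exists n, (b <= u n)%O.
  apply: contrapT => /forallNP nb; have : (m <= b)%O.
    by apply: mmin => n; rewrite ltNge; apply/negP; exact: nb.
  by rewrite leNgt bm.
by apply: lt_trans (mP n.+1); exact: (gP (u n)).2.
Qed.

Lemma omega1_code : exists code : W -> W -> nat -> W,
  (forall a b k a' b' k', code a b k = code a' b' k' -> [/\ a = a', b = b' & k = k']) /\
  exists h : W -> W, forall c, (forall x, (x < c)%O -> (h x < c)%O) ->
    forall a b k, (a < c)%O -> (b < c)%O -> (code a b k < c)%O.
Proof.
have [a00 _] := omega1_inhabited.
have /choice[nxt nxtP] : forall a, exists b, (a < b)%O.
  by move=> a; have [b bP] := omega1_bound (fun=> a); exists b; exact: (bP 0).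
have [base0 base0P] : exists base : (W -> W) -> W -> W, forall f a,
    (forall b n, (b < a)%O -> (iter n nxt (f b) < base f a)%O) /\
    forall g, (forall b, (b < a)%O -> f b = g b) -> base f a = base g a.
  have bnd f a : exists c, forall b n, (b < a)%O -> (iter n nxt (f b) < c)%O.
    have [/pred_enum[e [ea esurj]]|na] := pselect (exists b, (b < a)%O).
      have [c cP] := omega1_bound_countType (fun p : nat * nat => iter p.2 nxt (f (e p.1))).
      by exists c => b n /esurj[m <-]; exact: (cP (m, n)).
    by exists a00 => b n ba; case: na; exists b.
  have /choice[m mP] : forall fa : (W -> W) * W, exists c,
     (forall b n, (b < fa.2)%O -> (iter n nxt (fa.1 b) < c)%O) /\
     forall c', (forall b n, (b < fa.2)%O -> (iter n nxt (fa.1 b) < c')%O) -> (c <= c')%O.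
    by move=> [f a]; exact: wo_min (bnd f a).
  exists (fun f a => m (f, a)) => f a; split; first exact: (mP (f, a)).1.
  move=> g fg; apply: le_anti; apply/andP; split; apply: (mP (_, _)).2 => b n /= ba.
    by rewrite fg //; exact: (mP (g, a)).1.
  by rewrite -fg //; exact: (mP (f, a)).1.
have [base baseE] := wo_rec (fun a f g => (base0P f a).2 g) a00.
have baseP b a n : (b < a)%O -> (iter n nxt (base b) < base a)%O.
  by move=> ba; rewrite [base a]baseE; exact: (base0P base a).1.
have base_le a n : (base a <= iter n nxt (base a))%O.
  by elim: n => [|n IH] /=; rewrite ?lexx // (le_trans IH) // ltW.
have iter_inj a : injective (fun n => iter n nxt (base a)).
  have mono : {homo (fun n => iter n nxt (base a)) : m n / m < n >-> (m < n)%O}.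
    apply: (@homo_ltn W _ (fun x y => (x < y)%O)) => [y x z|n /=]; first exact: lt_trans.
    exact: nxtP.
  by move=> m n; case: (ltngtP m n) => // /mono; move=> + E; rewrite E ltxx.
pose slot a n := iter n nxt (base a).
have slot_inj a m b n : slot a m = slot b n -> a = b /\ m = n.
  move=> E; have ab : a = b.
    case: (ltgtP a b) => // ab.
      by have := lt_le_trans (baseP _ _ m ab) (base_le b n); rewrite -/(slot b n) -E ltxx.
    by have := lt_le_trans (baseP _ _ n ab) (base_le a m); rewrite -/(slot a m) E ltxx.
  by subst b; split=> //; exact: iter_inj E.
have /choice[idx idxP] : forall c, exists i : W -> nat, forall a b,
    (a <= c)%O -> (b <= c)%O -> i a = i b -> a = b.
  move=> c; case: W1 => _ _ /(_ (nxt c)) /countable_injP[f finj].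
  exists f => a b ac bc; apply: finj; rewrite inE /=.
    exact: le_lt_trans (nxtP c).
  exact: le_lt_trans (nxtP c).
pose code a b (k : nat) := let c := Order.max a b in slot c (pickle (idx c a, idx c b, k)).
exists code; split.
  move=> a b k a' b' k' /slot_inj[mE /(pcan_inj pickleK)].
  rewrite -mE => -[ia ib ->]; split=> //.
    by apply: idxP ia; [|rewrite mE]; rewrite le_max lexx ?orbT.
  by apply: idxP ib; [|rewrite mE]; rewrite le_max lexx ?orbT.
have /choice[h hP] : forall a, exists b, forall n, (slot a n < b)%O.
  by move=> a; exact: omega1_bound.
exists h => c hc a b k ac bc; apply: lt_trans (hP _ _) (hc _ _).
by rewrite gt_max ac bc.
Qed.

End Omega1.

(** * Searching for a point outside a thin set *)

Definition free_ultra (w : set (set nat)) : Prop :=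
  [/\ forall A B, w A -> w B -> w (A `&` B),
      forall A B : set nat, A `<=` B -> w A -> w B,
      forall A, w A \/ w (~` A) &
      forall A, w A -> inf_often A].

(* In state [(q, 0)] the search steps to the right of [q]; in state [(q, 1)] it
   picks the number of steps to the left that are going to follow, and [k.+2]
   means that [k.+1] of them remain. *)
Definition step (st : seq nat * nat) (m : nat) : seq nat * nat :=
  match st.2 with
  | 0 => (m.*2.+1 :: st.1, 1)
  | 1 => (st.1, m.+2)
  | k.+2 => (m.*2 :: st.1, if k is 0 then 0 else k.+1)
  end.

Lemma step_suffix st m : suffix st.1 (step st m).1.
Proof.
case: st => q [|[|k]] /=; rewrite ?suffix_refl //.
  exact: suffix_suffix [:: _] q.
exact: suffix_suffix [:: _] q.
Qed.

Section Thin.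
Context {d : Order.disp_t} (W : orderType d).
Hypothesis W1 : is_omega1 W.
Variable w : set (set nat).
Hypothesis wU : free_ultra w.

Definition boxT (A : seq nat * nat -> Prop) (st : seq nat * nat) : Prop :=
  w [set m | A (step st m)].

Lemma ultraI (A B : set nat) : w A -> w B -> w (A `&` B).
Proof. by case: wU => + _ _ _; exact. Qed.

Lemma ultraS (A B : set nat) : A `<=` B -> w A -> w B.
Proof. by case: wU => _ + _ _; exact. Qed.

Lemma ultraC (A : set nat) : ~ w A -> w (~` A).
Proof. by case: wU => _ _ + _ => /(_ A)[]. Qed.

Lemma ultra_inf (A : set nat) : w A -> inf_often A.
Proof. by case: wU => _ _ _; exact. Qed.

Lemma ultra_ge k : w [set m | k <= m].
Proof.
apply: contrapT => /ultraC/ultra_inf/(_ k)[j kj]; by apply.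
Qed.

Lemma ultra_nonempty (A : set nat) : w A -> exists m, A m.
Proof. by move=> /ultra_inf/(_ 0)[m _ Am]; exists m. Qed.

(* [lev j A x]: a typical sequence of [j] steps to the left of [x] ends in [A]. *)
Fixpoint lev (j : nat) (A : set (seq nat)) (x : seq nat) : Prop :=
  if j is j'.+1 then w [set m | lev j' A (m.*2 :: x)] else A x.

Lemma lev_S j (A B : set (seq nat)) x : A `<=` B -> lev j A x -> lev j B x.
Proof.
move=> AB; elim: j x => [|j IH] x /=; first exact: AB.
by apply: ultraS => m; exact: IH.
Qed.

Lemma levI j (A B : set (seq nat)) x : lev j A x -> lev j B x -> lev j (A `&` B) x.
Proof.
elim: j x => [|j IH] x //= wA wB; apply: ultraS (ultraI wA wB) => m [].
exact: IH.
Qed.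

Lemma levC j (A : set (seq nat)) x : ~ lev j A x -> lev j (~` A) x.
Proof.
elim: j x => [|j IH] x //= /ultraC; apply: ultraS => m; exact: IH.
Qed.

Lemma levD i j (A : set (seq nat)) x : lev (i + j) A x -> lev i (lev j A) x.
Proof.
by elim: i x => [|i IH] x //=; apply: ultraS => m; exact: IH.
Qed.

Lemma lev_ex j (A : set (seq nat)) x : lev j A x -> meets A x.
Proof.
elim: j x => [|j IH] x /=; first by exists x => //; exact: suffix_refl.
move=> /ultra_nonempty[m /IH]; apply: meets_suffix; exact: suffix_suffix [:: _] x.
Qed.

Variable N : set (seq nat).
Hypothesis thinN : forall D, crowdedT D -> D `<=` N -> D `<=` set0.

Let acc (b : bool) (A : set (seq nat)) (x : seq nat) :=
  inf_often (fun m => odd m = b /\ meets A (m :: x)).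

Lemma thin_derivative : exists Nd : W -> set (seq nat),
  (forall a x, Nd a x <-> N x /\ forall c, (c < a)%O -> forall b, acc b (Nd c) x) /\
  exists a, Nd a `<=` set0.
Proof.
have [a f g fg|Nd NdE] := @wo_rec _ _ W1 (set (seq nat))
    (fun a f => [set x | N x /\ forall c, (c < a)%O -> forall b, acc b (f c) x]) _ set0.
  apply/seteqP; split=> x [Nx H]; split=> // c ca b; [rewrite -fg//|rewrite fg//]; exact: H.
have NdP a x : Nd a x <-> N x /\ forall c, (c < a)%O -> forall b, acc b (Nd c) x.
  by rewrite {1}NdE.
exists Nd; split=> //.
have [a00 _] := omega1_inhabited W1.
have /choice[r rP] : forall x, exists a, (exists a, ~ Nd a x) -> ~ Nd a x.
  move=> x; have [[a na]|n] := pselect (exists a, ~ Nd a x); first by exists a.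
  by exists a00 => /n.
have [a aP] := omega1_bound_countType W1 r.
have NdS b c : (b <= c)%O -> Nd c `<=` Nd b.
  move=> bc x /NdP[Nx H]; apply/NdP; split=> // e eb; apply: H; exact: lt_le_trans bc.
have all x b : Nd a x -> Nd b x.
  move=> Nax; apply: contrapT => nb; apply: (rP x); first by exists b.
  by apply: NdS Nax; apply: ltW; exact: aP.
exists a; apply: thinN.
  move=> x Nax b; have [c ac] := omega1_bound W1 (fun=> a).
  have /NdP[_ /(_ a)] := all x c Nax; apply; exact: (ac 0).
by move=> x /NdP[].
Qed.

Lemma thin_search : exists (St : seq nat * nat -> Prop) (rk : seq nat * nat -> W),
  (forall st, St st -> (st.2 = 0 -> ~ N st.1) /\ boxT St st) /\
  (forall st, St st \/ boxT (fun st' => (rk st' < rk st)%O) st).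
Proof.
have [Nd [NdP [atop Ndtop]]] := thin_derivative.
have [a00 _] := omega1_inhabited W1.
have /choice[M MP] : forall x, exists a, (forall b, ~ acc b (Nd a) x) /\
    forall a', (forall b, ~ acc b (Nd a') x) -> (a <= a')%O.
  move=> x; apply: (wo_min W1); exists atop => b /(_ 0)[m _ [_ [t /Ndtop]]]; by [].
have M_child x : exists k, forall m, k <= m -> (M (m :: x) <= M x)%O.
  have H b := not_inf_often ((MP x).1 b).
  have [k0 k0P] := H false; have [k1 k1P] := H true.
  exists (maxn k0 k1) => m; rewrite geq_max => /andP[k0m k1m].
  apply: (MP (m :: x)).2 => b /(_ 0)[j _ [_ jm]].
  have mm : meets (Nd (M x)) (m :: x) by apply: meets_suffix jm; exact: suffix_suffix [:: _] _.
  by case om : (odd m); [apply: (k1P m)|apply: (k0P m)].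
have M_meets x c : (c < M x)%O -> meets (Nd c) x.
  move=> cM; have /existsNP[b /contrapT] : ~ forall b, ~ acc b (Nd c) x.
    by move=> /(MP x).2; rewrite leNgt cM.
  move=> /(_ 0)[m _ [_]]; apply: meets_suffix; exact: suffix_suffix [:: _] _.
have M_step st : boxT (fun st' => (M st'.1 <= M st.1)%O) st.
  have [k kP] := M_child st.1; apply: ultraS (ultra_ge k) => m /= km.
  by case: st kP => q [|[|j]] //= kP; apply: kP; rewrite -addnn; lia.
pose St st := exists A : seq nat * nat -> Prop, A st /\
  forall st', A st' -> (st'.2 = 0 -> ~ N st'.1) /\ boxT A st'.
have StP st : St st -> (st.2 = 0 -> ~ N st.1) /\ boxT St st.
  move=> [A [Ast AP]]; have [? wA] := AP _ Ast; split=> //.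
  by apply: ultraS wA => m Am; exists A.
have [a f g fg|R RE] := @wo_rec _ _ W1 (seq nat * nat -> Prop)
    (fun a f st => St st \/ boxT (fun st' => exists2 b, (b < a)%O & f b st') st) _ (fun=> False).
  apply/funext => st; apply/propext.
  split=> -[?|H]; [by left| |by left| ]; right; apply: ultraS H => m [b ba Hb].
    by exists b => //; rewrite -fg.
  by exists b => //; rewrite fg.
have RP a st : R a st <-> St st \/ boxT (fun st' => exists2 b, (b < a)%O & R b st') st.
  by rewrite {1}RE.
suff ranked st : exists a, R a st.
  have /choice[rk rkP] : forall st, exists a, R a st /\ forall b, R b st -> (a <= b)%O.
    by move=> st; exact: (wo_min W1).
  exists St, rk; split=> // st; have [/RP[?|H] _] := rkP st; [by left|right].
  by apply: ultraS H => m [b ba Rb]; apply: le_lt_trans ba; exact: (rkP _).2.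
apply: contrapT => /forallNP nR.
pose G st := forall a, ~ R a st.
have Gst : G st by [].
have G_St st' : G st' -> ~ St st' by move=> /(_ a00) + Sst; apply; apply/RP; left.
have G_box st' : G st' -> boxT G st'.
  move=> Gst'; apply: contrapT => /ultraC wn.
  have /choice[f fP] : forall m, exists a, (exists a, R a (step st' m)) -> R a (step st' m).
    move=> m; have [[a Ra]|n] := pselect (exists a, R a (step st' m)); first by exists a.
    by exists a00 => /n.
  have [a aP] := omega1_bound W1 f; apply: (Gst' a); apply/RP; right.
  apply: ultraS wn => m /existsNP[c /contrapT Rc]; exists (f m) => //.
  by apply: fP; exists c.
have [rho [[st0 [Gst0 Mst0]] rho_min]] :=
  wo_min W1 (ex_intro (fun a => exists st, G st /\ M st.1 = a) _ (ex_intro _ st (conj Gst erefl))).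
pose Gr st := G st /\ M st.1 = rho.
have Gr_box st' : Gr st' -> boxT Gr st'.
  move=> [Gst' Mst']; apply: ultraS (ultraI (G_box _ Gst') (M_step st')) => m [Gm Mm].
  split=> //; apply: le_anti; rewrite -{1}Mst' Mm /=.
  by apply: rho_min; exists (step st' m).
have Gr_lev k q : Gr (q, k.+2) -> lev k.+1 [set x | Gr (x, 0)] q.
  elim: k q => [|k IH] q /Gr_box wG; first exact: wG.
  by apply: ultraS wG => m; exact: IH.
have [q0 Grq0] : exists q, Gr (q, 1).
  have G0 q : Gr (q, 0) -> exists q, Gr (q, 1).
    by move=> /Gr_box/ultra_nonempty[m Gm]; eexists; exact: Gm.
  have : Gr st0 by [].
  case: (st0) => q [|[|k]]; [exact: G0|by exists q|].
  by move=> /Gr_lev/lev_ex[x Gx _]; exact: G0 Gx.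
have [q [Grq wN]] : exists q, Gr (q, 1) /\ w [set i | lev i.+1 N q].
  apply: contrapT => /forallNP nq; apply: (G_St _ Grq0.1).
  exists (fun st => Gr st /\ match st.2 with
      | 0 => ~ N st.1 | 1 => True | k.+2 => lev k.+1 (~` N) st.1 end).
  split=> // -[q k] [Gqk]; have wG := Gr_box _ Gqk.
  case: k Gqk wG => [|[|k]] Gqk wG /= H.
  - by split=> //; apply: ultraS wG => m.
  - split=> //; have /ultraC wn : ~ w [set i | lev i.+1 N q] by move=> ?; apply: (nq q).
    by apply: ultraS (ultraI wG wn) => i [Gi /levC].
  - split=> //; apply: ultraS (ultraI wG H) => m [Gm lm]; split=> //=.
    by case: (k) lm.
pose P := [set x | [/\ N x, M x = rho & forall c, (c < rho)%O -> acc true (Nd c) x]].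
have levP i : lev i.+1 N q -> Gr (q, i.+2) -> lev i.+1 P q.
  move=> lN /Gr_lev lG; apply: lev_S (levI lN lG) => x [Nx Gx].
  split=> // [|c cr]; first by case: Gx.
  have /ultra_inf H := Gr_box _ Gx.
  apply: (@inf_often_inj (fun m => m.*2.+1)); first by move=> m n [/double_inj].
  apply: inf_oftenS H => m [_ /= Mm]; split; first by rewrite /= odd_double.
  by apply: M_meets; rewrite Mm.
have wP : w [set i | lev i.+1 P q].
  by apply: ultraS (ultraI wN (Gr_box _ Grq)) => i [li Gi]; exact: levP.
have [i0 _ li0] := ultra_inf wP 0.
have [i1 i01 li1] := ultra_inf wP i0.+1.
have [i2 i12 li2] := ultra_inf wP i1.+1.
have balanced j y : P y -> lev j.+1 P y -> Nd rho y.
  move=> [Ny My accy] ly; apply/NdP; split=> // c cr [] //; first exact: accy.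
  have /ultra_inf H := ly.
  apply: (@inf_often_inj double); first exact: double_inj.
  apply: inf_oftenS H => m /lev_ex[t [_ Mt _] mt]; split; first by rewrite odd_double.
  by apply: meets_suffix mt _; apply: M_meets; rewrite Mt.
have [k1 k1E] : exists k, i1.+1 = i0.+1 + k.+1 by exists (i1 - i0.+1); lia.
have [k2 k2E] : exists k, i2.+1 = i0.+1 + (k1.+1 + k.+1) by exists (i2 - i1.+1); lia.
have {}li1 : lev i0.+1 (lev k1.+1 P) q by apply: levD; rewrite -k1E.
have {}li2 : lev i0.+1 (lev (k1.+1 + k2.+1) P) q by apply: levD; rewrite -k2E.
have /lev_ex[x [Px [lx1 lx2]] _] := levI li0 (levI li1 li2).
have lx := levI lx1 (levD lx2).
have [_ Mx _] := Px.
apply: ((MP x).1 false); rewrite Mx.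
apply: (@inf_often_inj double); first exact: double_inj.
have /ultra_inf H := lx; apply: inf_oftenS H => m /lev_ex[t [Pt lt] mt].
split; first by rewrite odd_double.
by exists t => //; exact: balanced lt.
Qed.

End Thin.

Section Jump.
Context {d : Order.disp_t} (W : orderType d).
Hypothesis W1 : is_omega1 W.
Variables (J : seq nat * nat -> nat) (B : seq nat * nat -> seq W).

Let below (x : W) (o : option W) := if o is Some b then (x < b)%O else true.

Let cand (p : (seq nat * nat) * option W) := [seq x <- B p.1 | below x p.2].

Let stop (p : (seq nat * nat) * option W) := (p.1.2 == 0) && (cand p == [::]).

Let bump (p : (seq nat * nat) * option W) : option W :=
  if p.1.2 == 0 then
    if cand p is x :: l then Some (foldr Order.max x l) else p.2
  else p.2.

Let adv (p : (seq nat * nat) * option W) := (step p.1 (J p.1), bump p).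

Lemma foldr_max_ge (x y : W) l : y \in x :: l -> (y <= foldr Order.max x l)%O.
Proof.
elim: l => [|z l IH] /=; first by rewrite inE => /eqP ->.
rewrite !inE le_max => /or3P[yx|/eqP ->|yl]; last first.
- by rewrite IH ?inE ?yl ?orbT.
- by rewrite lexx.
- by rewrite IH ?inE ?yx ?orbT.
Qed.

Lemma foldr_max_mem (x : W) l : foldr Order.max x l \in x :: l.
Proof.
elim: l => [|z l IH] /=; first by rewrite inE.
rewrite maxElt; case: ifP => _; last by rewrite !inE eqxx orbT.
by move: IH; rewrite !inE => /orP[->|->]; rewrite ?orbT.
Qed.

Lemma adv_reach p : exists j, (iter j adv p).1.2 = 0 /\ (iter j adv p).2 = p.2.
Proof.
have H k q o : exists j, (iter j adv ((q, k.+2), o)).1.2 = 0 /\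
    (iter j adv ((q, k.+2), o)).2 = o.
  elim: k q => [|k IH] q; first by exists 1.
  have [j] := IH ((J (q, k.+3)).*2 :: q).
  by exists j.+1; rewrite iterSr.
case: p => -[q [|[|k]]] o; [by exists 0| |exact: H].
have [j] := H (J (q, 1)) q o; by exists j.+1; rewrite iterSr.
Qed.

Lemma stop_bounded b p : p.2 = Some b -> exists j, stop (iter j adv p).
Proof.
elim/(wo_ind W1): b p => b IH p pb.
have [j [j0 jo]] := adv_reach p.
have [sj|nsj] := boolP (stop (iter j adv p)); first by exists j.
case E : (cand (iter j adv p)) => [|x l]; first by move: nsj; rewrite /stop j0 E.
have := foldr_max_mem x l; rewrite -E mem_filter => /andP[+ _].
rewrite jo pb /= => xb.
have [|i] := IH _ xb (adv (iter j adv p)); first by rewrite /= /bump j0 E.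
by rewrite -iterS -iterD; exists (i + j.+1).
Qed.

Lemma stop_exists s : exists j, stop (iter j adv ((s, 0), None)).
Proof.
have [s0|ns] := boolP (stop ((s, 0), None)); first by exists 0.
case E : (cand ((s, 0), None)) => [|x l]; first by move: ns; rewrite /stop E.
have [|i] := @stop_bounded (foldr Order.max x l) (adv ((s, 0), None)).
  by rewrite /= /bump E.
by rewrite -iterSr; exists i.+1.
Qed.

(* The true rank of the current state lies in the finite list proposed by [B]
   and decreases, hence stays below the bound read off from that list; since
   the bounds decrease too, the search stops, and only in a safe state. *)
Lemma jump_exists : exists jmp : seq nat -> seq nat, (forall s, suffix s (jmp s)) /\
  forall (N : set (seq nat)) (St : seq nat * nat -> Prop) (rk : seq nat * nat -> W),
    (forall st, St st -> (st.2 = 0 -> ~ N st.1) /\ St (step st (J st))) ->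
    (forall st, St st \/ (rk (step st (J st)) < rk st)%O) ->
    (forall st, rk st \in B st) ->
    forall s, ~ N (jmp s).
Proof.
have /choice[j jP] := stop_exists.
exists (fun s => (iter (j s) adv ((s, 0), None)).1.1); split.
  move=> s; elim: (j s) => [|i IH] /=; first exact: suffix_refl.
  exact: suffix_trans IH (step_suffix _ _).
move=> N St rk StP rkP rkB s.
have inv i : let p := iter i adv ((s, 0), None) in St p.1 \/ below (rk p.1) p.2.
  elim: i => [|i /=]; first by right.
  set p := iter i adv _ => -[Sp|bp]; first by left; exact: (StP _ Sp).2.
  have [Sp|rs] := rkP p.1; first by left; exact: (StP _ Sp).2.
  right; rewrite /bump; case: eqP => _; last first.
    by move: bp; rewrite /below; case: p.2 => // b; exact: lt_trans.
  have : rk p.1 \in cand p by rewrite mem_filter bp rkB.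
  case: (cand p) => // x l /foldr_max_ge; exact: lt_le_trans.
have /andP[/eqP p0 /eqP pc] := jP s.
have [Sp|bp] := inv (j s); first exact: (StP _ Sp).1.
have : rk (iter (j s) adv ((s, 0), None)).1 \in cand (iter (j s) adv ((s, 0), None)).
  by rewrite mem_filter bp rkB.
by rewrite pc.
Qed.

End Jump.

(** * Borel dependence on countably many coordinates *)

Section Bor.
Context {d : Order.disp_t} (W : orderType d).

(* The sequences of length omega_1 of reals, with a second ordinal index that
   serves to record ordinals. *)
Definition seqs : Type := W -> W -> nat -> bool.

Inductive bor (a : W) : (seqs -> Prop) -> Prop :=
| bor_coord x y k : (x < a)%O -> (y < a)%O -> bor a (fun om => om x y k)
| bor_cst (P : Prop) : bor a (fun=> P)
| bor_not P : bor a P -> bor a (fun om => ~ P om)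
| bor_exn (P : nat -> seqs -> Prop) : (forall n, bor a (P n)) ->
    bor a (fun om => exists n, P n om).

Lemma bor_ext a (P Q : seqs -> Prop) :
  (forall om, P om <-> Q om) -> bor a P -> bor a Q.
Proof. by move=> PQ; have -> : P = Q by apply/funext => om; exact/propext. Qed.

Lemma bor_ex (T : countType) a (P : T -> seqs -> Prop) :
  (forall t, bor a (P t)) -> bor a (fun om => exists t, P t om).
Proof.
move=> bP; apply: (@bor_ext a (fun om => exists n,
    if unpickle n is Some t then P t om else False)).
  move=> om; split=> [[n]|[t Pt]]; first by case: unpickle => // t Pt; exists t.
  by exists (pickle t); rewrite pickleK.
by apply: bor_exn => n; case: unpickle => [t|]; [exact: bP|exact: bor_cst].
Qed.

Lemma bor_all (T : countType) a (P : T -> seqs -> Prop) :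
  (forall t, bor a (P t)) -> bor a (fun om => forall t, P t om).
Proof.
move=> bP; apply: (@bor_ext a (fun om => ~ exists t, ~ P t om)).
  by move=> om; split=> [H t|H [t]]; [apply: contrapT => nP; apply: H; exists t|apply].
by apply: bor_not; apply: bor_ex => t; exact: bor_not.
Qed.

Lemma bor_and a P Q : bor a P -> bor a Q -> bor a (fun om => P om /\ Q om).
Proof.
move=> bP bQ; apply: (@bor_ext a (fun om => forall b : bool, if b then P om else Q om)).
  by move=> om; split=> [H|[HP HQ] []//]; split; [exact: (H true)|exact: (H false)].
by apply: bor_all => -[].
Qed.

Lemma bor_imp a P Q : bor a P -> bor a Q -> bor a (fun om => P om -> Q om).
Proof.
move=> bP bQ; apply: (@bor_ext a (fun om => ~ (P om /\ ~ Q om))).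
  by move=> om; rewrite not_andP notE; split=> [[//|//]|H]; have [/H|] := pselect (P om); [right|left].
by apply: bor_not; apply: bor_and => //; exact: bor_not.
Qed.

Definition borf (T : Type) (a : W) (f : seqs -> T) : Prop :=
  forall v, bor a (fun om => f om = v).

Lemma borf_cst (T : Type) a (v : T) : borf a (fun=> v).
Proof. by move=> u; exact: bor_cst. Qed.

Lemma bor_bind (T : countType) a (f : seqs -> T) (P : T -> seqs -> Prop) :
  borf a f -> (forall t, bor a (P t)) -> bor a (fun om => P (f om) om).
Proof.
move=> bf bP; apply: (@bor_ext a (fun om => exists t, f om = t /\ P t om)).
  by move=> om; split=> [[t [<-]]|] //; exists (f om).
by apply: bor_ex => t; apply: bor_and.
Qed.

Lemma borf_bind (T : countType) (U : Type) a (f : seqs -> T) (g : T -> seqs -> U) :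
  borf a f -> (forall t, borf a (g t)) -> borf a (fun om => g (f om) om).
Proof. by move=> bf bg v; apply: (bor_bind (P := fun t om => g t om = v)) => // t; exact: bg. Qed.

End Bor.

(* Junk value [0] when no number satisfies [P]. *)
Definition least (P : nat -> Prop) : nat :=
  xget 0 [set n | P n /\ forall m, P m -> n <= m].

Lemma leastP (P : nat -> Prop) :
  (exists n, P n) -> P (least P) /\ forall m, P m -> least P <= m.
Proof.
move=> [n Pn]; apply: (@xgetPex _ 0 [set n | P n /\ forall m, P m -> n <= m]).
have exP : exists n, `[< P n >] by exists n; apply/asboolP.
exists (ex_minn exP); case: ex_minnP => m /asboolP Pm mmin; split=> // k Pk.
by apply: mmin; apply/asboolP.
Qed.

Lemma borf_least {d : Order.disp_t} (W : orderType d) (a : W) (P : nat -> seqs W -> Prop) :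
  (forall n, bor a (P n)) -> borf a (fun om => least (P^~ om)).
Proof.
move=> bP v.
apply: (@bor_ext _ _ a (fun om => ((exists n, P n om) ->
    P v om /\ forall m, P m om -> v <= m) /\ ((~ exists n, P n om) -> v = 0))).
  move=> om; split=> [[H1 H2]|<-].
    have [ex|nex] := pselect (exists n, P n om).
      have [Pl lmin] := leastP ex; have [Pv vmin] := H1 ex.
      by apply/eqP; rewrite eqn_leq lmin // vmin.
    by rewrite H2 //; apply: xgetPN => n [Pn _]; apply: nex; exists n.
  split=> [|nex]; first exact: leastP.
  by apply: xgetPN => n [Pn _]; apply: nex; exists n.
apply: bor_and; apply: bor_imp.
- exact: bor_exn.
- apply: bor_and => //; apply: bor_all => m; apply: bor_imp => //; exact: bor_cst.
- by apply: bor_not; exact: bor_exn.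
- exact: bor_cst.
Qed.

(* The diamond principle transported to the tree and to sequences of reals; the
   reaping levels may moreover be taken closed under a given function. *)
Definition diamondT {d : Order.disp_t} (W : orderType d) : Prop :=
  forall F : W -> seqs W -> set (seq nat),
    (forall a t, bor a (fun om => F a om t)) ->
    exists g : W -> set (seq nat), (forall a, perfT (g a)) /\
      forall (om : seqs W) (h : W -> W) a0, exists a,
        [/\ (a0 < a)%O, forall x, (x < a)%O -> (h x < a)%O & reapsT (g a) (F a om)].

Section Tower.
Context {d : Order.disp_t} (W : orderType d).
Hypothesis W1 : is_omega1 W.
Hypothesis dia : diamondT W.
Variable lad : W -> nat -> W.
Hypothesis lad_lt : forall a, (exists b, (b < a)%O) -> forall n, (lad a n < a)%O.
Hypothesis lad_homo : forall a, (exists b, (b < a)%O) ->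
  {homo lad a : m n / m <= n >-> (m <= n)%O}.
Hypothesis lad_cof : forall a, (exists b, (b < a)%O) ->
  forall b, (b < a)%O -> exists n, (b <= lad a n)%O.

Definition almost_sub (A B : set nat) : Prop :=
  exists k, forall v, k <= v -> A v -> B v.

Lemma almost_sub_trans A B C : almost_sub A B -> almost_sub B C -> almost_sub A C.
Proof.
move=> [k kP] [l lP]; exists (maxn k l) => v; rewrite geq_max => /andP[kv lv] Av.
by apply: lP => //; exact: kP.
Qed.

(* A pseudo-intersection of the [P n]. *)
Fixpoint pseudo (P : nat -> nat -> Prop) (n : nat) : nat :=
  if n is m.+1 then least (fun v => pseudo P m < v /\ forall j, j <= n -> P j v)
  else least (P 0).

Lemma pseudoP (P : nat -> set nat) : (forall n, inf_often (P n)) ->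
  (forall m n, m <= n -> almost_sub (P n) (P m)) ->
  {homo pseudo P : m n / m < n} /\ forall n j, j <= n -> P j (pseudo P n).
Proof.
move=> iP sP.
have ex n k : exists v, k < v /\ forall j, j <= n -> P j v.
  have /choice[f fP] : forall j, exists l, j <= n -> forall v, l <= v -> P n v -> P j v.
    move=> j; have [jn|_] := leqP j n; last by exists 0.
    by have [l lP] := sP _ _ jn; exists l.
  have [v + Pv] := iP n (maxn k.+1 (\max_(j < n.+1) f j)).
  rewrite geq_max => /andP[kv fv]; exists v; split=> // j jn; apply: (fP j) => //.
  by apply: leq_trans fv; exact: (leq_bigmax (F := fun j : 'I_n.+1 => f j) (Ordinal (jn : j < n.+1))).
split.
  apply: (@homo_ltn _ _ (fun m n => m < n)) => [y x z|n]; first exact: ltn_trans.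
  exact: (leastP (ex n.+1 (pseudo P n))).1.1.
case=> [|n] j; last exact: (leastP (ex n.+1 (pseudo P n))).1.2.
rewrite leqn0 => /eqP ->; apply: (leastP _).1.
by have [v [_ /(_ 0 isT)]] := ex 0 0; exists v.
Qed.

Lemma borf_pseudo a (P : nat -> nat -> seqs W -> Prop) n :
  (forall j v, bor a (P j v)) -> borf a (fun om => pseudo (fun j v => P j v om) n).
Proof.
move=> bP; elim: n => [|n IH] /=; first by apply: (borf_least (P := P 0)).
apply: (borf_bind (g := fun t om => least (fun v => t < v /\ forall j, j <= n.+1 -> P j v om)) IH) => t.
apply: (borf_least (P := fun v om => t < v /\ forall j, j <= n.+1 -> P j v om)) => v.
apply: bor_and; first exact: bor_cst.
by apply: bor_all => j; apply: bor_imp => //; exact: bor_cst.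
Qed.

Lemma ultra_tower : exists I : W -> set nat,
  [/\ forall a, inf_often (I a), forall a b, (b < a)%O -> almost_sub (I a) (I b) &
      forall C, exists a, almost_sub (I a) C \/ almost_sub (I a) (~` C)].
Proof.
pose nu a (om : seqs W) := pseudo (fun j v => om (lad a j) (lad a j) v.*2).
pose F a om : set (seq nat) := if pselect (exists b, (b < a)%O) is left _ then
   [set s | om (lad a 0) (lad a 0) (nu a om (colT s)).*2.+1] else set0.
have bF a t : bor a (fun om => F a om t).
  rewrite /F; case: pselect => [pa|_]; last exact: bor_cst.
  apply: (bor_bind (P := fun v om => om (lad a 0) (lad a 0) v.*2.+1)).
    apply: (borf_pseudo (P := fun j v om => om (lad a j) (lad a j) v.*2)) => j v.
    by apply: bor_coord; exact: lad_lt.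
  by move=> v; apply: bor_coord; exact: lad_lt.
have [g [pg gP]] := dia bF.
have [a00 _] := omega1_inhabited W1.
pose body a (f : W -> set nat) : set nat := if pselect (exists b, (b < a)%O) is left _ then
   [set v | exists2 n, meets (g a) [:: n] & v = pseudo (fun j => f (lad a j)) n] else setT.
have [a f1 f2 f12|I IE] := wo_rec W1 (F := body) _ set0.
  rewrite /body; case: pselect => // pa.
  suff -> : (fun j => f1 (lad a j)) = (fun j => f2 (lad a j)) by [].
  by apply/funext => j; apply: f12; exact: lad_lt.
have tower a : inf_often (I a) /\ forall b, (b < a)%O -> almost_sub (I a) (I b).
  elim/(wo_ind W1): a => a IH; rewrite IE /body; case: pselect => [pa|npa]; last first.
    split=> [k|b ba]; first by exists k.
    by case: npa; exists b.
  have ipl n : inf_often (I (lad a n)) by have [] := IH _ (lad_lt pa n).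
  have spl m n : m <= n -> almost_sub (I (lad a n)) (I (lad a m)).
    move=> /(lad_homo pa); rewrite le_eqVlt => /orP[/eqP ->|]; first by exists 0.
    by have [_] := IH _ (lad_lt pa n); apply.
  have [mono memb] := pseudoP ipl spl.
  split=> [k|b ba].
    have [_ _ _ gu] := pg a.
    have pinj : injective (pseudo (fun j => I (lad a j))).
      move=> m n; case: (ltngtP m n) => // /mono; by move=> + E; rewrite E ltnn.
    by apply: (inf_often_inj pinj); apply: inf_oftenS gu => n gn; exists n.
  have [n bn] := lad_cof pa ba.
  have : almost_sub (I (lad a n)) (I b).
    move: bn; rewrite le_eqVlt => /orP[/eqP ->|]; first by exists 0.
    by have [_] := IH _ (lad_lt pa n); apply.
  apply: almost_sub_trans; exists (pseudo (fun j => I (lad a j)) n) => v nv [m gm vE].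
  rewrite vE; apply: memb; rewrite leqNgt; apply/negP => /mono.
  by rewrite -vE ltnNge nv.
exists I; split=> [a|a|C]; [by case: (tower a)|by case: (tower a)|].
pose om : seqs W := fun x y k => if odd k then `[< C k./2 >] else `[< I x k./2 >].
have omI x y k : om x y k.*2 = I x k :> Prop.
  by rewrite /om odd_double doubleK; apply/propext; split=> /asboolP.
have omC x y k : om x y k.*2.+1 = C k :> Prop.
  by rewrite /om /= odd_double /= uphalf_double; apply/propext; split=> /asboolP.
have [a [a0a _ ra]] := gP om id a00; exists a.
have pa : exists b, (b < a)%O by exists a00.
have ipl n : inf_often (I (lad a n)) by case: (tower (lad a n)).
have spl m n : m <= n -> almost_sub (I (lad a n)) (I (lad a m)).
  move=> /(lad_homo pa); rewrite le_eqVlt => /orP[/eqP ->|]; first by exists 0.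
  by have [_] := tower (lad a n); apply.
have [mono _] := pseudoP ipl spl.
have nuE : nu a om = pseudo (fun j => I (lad a j)).
  by congr pseudo; apply/funext => j; apply/funext => v; rewrite omI.
have FE : F a om = [set s | C (pseudo (fun j => I (lad a j)) (colT s))].
  rewrite /F; case: pselect => // _; apply/seteqP; split=> s; by rewrite /= omC nuE.
have key (D : set nat) : ~ posT [set s | g a s /\ D (pseudo (fun j => I (lad a j)) (colT s))] ->
    almost_sub (I a) (~` D).
  move=> nD; have [|k kP] := @not_inf_often
      (fun n => D (pseudo (fun j => I (lad a j)) n) /\ meets (g a) [:: n]).
    move=> iD; apply: nD.
    by eexists; [exact: (perfT_cols (pg a) iD)|].
  exists (pseudo (fun j => I (lad a j)) k) => v kv.
  rewrite IE /body; case: pselect => // _ [n gn vE] Dv; apply: (kP n); last by rewrite -vE.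
  by rewrite leqNgt; apply/negP => /mono; rewrite -vE ltnNge kv.
case: ra; rewrite FE => nr; [left|right].
  have [k kP] := key (~` C) nr; exists k => v kv Iv; apply: contrapT; exact: kP.
exact: key nr.
Qed.

End Tower.

Lemma seq_bound (T : eqType) (u : seq T) (f : T -> nat) :
  exists k, forall t, t \in u -> f t < k.
Proof.
elim: u => [|x u [k kP]]; first by exists 0.
exists (maxn (f x).+1 k) => t; rewrite inE leq_max => /orP[/eqP ->|/kP ->];
  by rewrite ?leqnn ?orbT.
Qed.

Section Guess.
Context {d : Order.disp_t} (W : orderType d).
Hypothesis W1 : is_omega1 W.
Hypothesis dia : diamondT W.
Variable lad : W -> nat -> W.
Hypothesis lad_lt : forall a, (exists b, (b < a)%O) -> forall n, (lad a n < a)%O.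
Variable I : W -> set nat.
Hypothesis I_inf : forall a, inf_often (I a).
Hypothesis I_sub : forall a b, (b < a)%O -> almost_sub (I a) (I b).
Hypothesis I_ultra : forall C, exists a, almost_sub (I a) C \/ almost_sub (I a) (~` C).

Definition tower_ultra : set (set nat) := [set C | exists a, almost_sub (I a) C].

Lemma tower_free_ultra : free_ultra tower_ultra.
Proof.
have sub_le a b : (a <= b)%O -> almost_sub (I b) (I a).
  by rewrite le_eqVlt => /orP[/eqP ->|/I_sub//]; exists 0.
have meet A B a : almost_sub (I a) A -> almost_sub (I a) B -> almost_sub (I a) (A `&` B).
  move=> [k kP] [l lP]; exists (maxn k l) => v; rewrite geq_max => /andP[kv lv] Iv.
  by split; [exact: kP|exact: lP].
split.
- move=> A B [a aA] [b bB].
  have [ab|/ltW ba] := leP a b.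
    by exists b; apply: meet => //; apply: almost_sub_trans aA; exact: sub_le.
  by exists a; apply: meet => //; apply: almost_sub_trans bB; exact: sub_le.
- by move=> A B AB [a [k kP]]; exists a, k => v kv Iv; apply: AB; exact: kP.
- by move=> C; have [a []] := I_ultra C; [left|right]; exists a.
- move=> A [a [k kP]] l; have [v + Iv] := I_inf a (maxn k l).
  by rewrite geq_max => /andP[kv lv]; exists v => //; exact: kP.
Qed.

Let enum_ex : exists e : W -> nat -> W, forall a, (exists b, (b < a)%O) ->
  (forall n, (e a n < a)%O) /\ forall b, (b < a)%O -> exists n, e a n = b.
Proof.
have [a00 _] := omega1_inhabited W1.
have /choice[e eP] : forall a, exists e : nat -> W, (exists b, (b < a)%O) ->
  (forall n, (e n < a)%O) /\ forall b, (b < a)%O -> exists n, e n = b.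
  move=> a; have [pa|npa] := pselect (exists b, (b < a)%O); last by exists (fun=> a00).
  by have [e eP] := pred_enum W1 pa; exists e.
by exists e.
Qed.

(* If [D] collects, in column [k], the points whose code is below [phi j] for
   some [j <= k], then a set reaping [leftof D] has points of [D] in finitely
   many columns only, so that its enumeration dominates [phi]. *)
Lemma guess : exists (J : W -> nat -> nat -> nat) (B : W -> nat -> nat -> seq W),
  forall (C : W -> nat -> set nat) (rho : W -> nat -> W),
    (forall x k, tower_ultra (C x k)) ->
    forall (h : W -> W) a0, exists a,
      [/\ (a0 < a)%O, forall x, (x < a)%O -> (h x < a)%O &
          exists n0, forall n k, n0 <= n ->
            C (lad a n) k (J a n k) /\ rho (lad a n) k \in B a n k].
Proof.
have [e eP] := enum_ex.
pose dec (k : nat) : nat * nat := odflt (0, 0) (unpickle k).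
have decK (p : nat * nat) : dec (pickle p) = p by rewrite /dec pickleK.
pose exc a k (om : seqs W) := least (fun x => forall v, x <= v -> I a v ->
  om (lad a (dec k).1) (lad a (dec k).1) (pickle ((dec k).2, v)).*2).
pose idx a k (om : seqs W) := least (fun i =>
  om (lad a (dec k).1) (e a i) (dec k).2.*2.+1).
pose D a (om : seqs W) : set (seq nat) :=
  [set t | t <> [::] /\ exists k, k <= colT t /\
     (pickle t < exc a k om \/ pickle t < idx a k om)].
pose F a om : set (seq nat) :=
  if pselect (exists b, (b < a)%O) is left _ then leftof (D a om) else set0.
have bF a t : bor a (fun om => F a om t).
  rewrite /F; case: pselect => [pa|_]; last exact: bor_cst.
  have bD s : bor a (fun om => D a om s).
    apply: bor_and; first exact: bor_cst.
    apply: bor_ex => k; apply: bor_and; first exact: bor_cst.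
    apply: (@bor_ext _ _ a (fun om => exists b : bool,
       if b then pickle s < exc a k om else pickle s < idx a k om)).
      by move=> om; split=> [[[]]|[]]; [left|right|exists true|exists false].
    apply: bor_ex => -[].
      apply: (bor_bind (P := fun v om => pickle s < v)); last by move=> v; exact: bor_cst.
      apply: borf_least => x; apply: bor_all => v; apply: bor_imp; first exact: bor_cst.
      by apply: bor_imp; [exact: bor_cst|apply: bor_coord; exact: lad_lt].
    apply: (bor_bind (P := fun v om => pickle s < v)); last by move=> v; exact: bor_cst.
    apply: borf_least => x; apply: bor_coord; first exact: lad_lt.
    exact: (eP a pa).1.
  apply: (@bor_ext _ _ a (fun om => exists p : seq nat * nat, D a om p.1 /\
    ((suffix (p.2 :: p.1) t /\ ~~ odd p.2) /\
     forall d', D a om d' -> suffix d' t -> suffix d' p.1))).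
    move=> om; split=> [[[s m] /= [Ds [[st om'] H]]]|[s [m [Ds st om' H]]]].
      by exists s, m.
    by exists (s, m).
  apply: bor_ex => p; apply: bor_and => //; apply: bor_and; first exact: bor_cst.
  by apply: bor_all => d'; apply: bor_imp => //; exact: bor_cst.
have [g [pg gP]] := dia bF.
pose nxt a k := least (fun n => k <= n /\ meets (g a) [:: n]).
pose bd a k := least (fun v => exists t, [/\ g a t, colT t = nxt a k & pickle t = v]).
have g0 a : ~ g a [::] by case: (pg a).
have bdP a k : exists t, [/\ g a t, k <= colT t & pickle t = bd a k].
  have [_ _ _ /(_ k)[n kn gn]] := pg a.
  have [] := @leastP (fun n => k <= n /\ meets (g a) [:: n]); first by exists n.
  rewrite -/(nxt a k) => -[kn' [t gt nt]] _.
  have [] := @leastP (fun v => exists t, [/\ g a t, colT t = nxt a k & pickle t = v]).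
    by exists (pickle t), t; rewrite (colT_suffix _ nt).
  by rewrite -/(bd a k) => -[s [gs cs ps]] _; exists s; rewrite cs.
pose J a (n k : nat) := least (fun v => I a v /\ bd a (pickle (n, k)) <= v).
pose B a (n k : nat) := [seq e a i | i <- iota 0 (bd a (pickle (n, k))).+1].
exists J, B => C rho wC h a0.
have /choice[eta etaP] : forall xk : W * nat, exists b, almost_sub (I b) (C xk.1 xk.2).
  by move=> [x k]; exact: wC.
have /choice[H HP] : forall x, exists b, [/\ (h x < b)%O, forall k, (rho x k < b)%O &
    forall k, (eta (x, k) < b)%O].
  move=> x; have [b bP] := omega1_bound W1
    (fun n => if n is m.+1 then Order.max (rho x m) (eta (x, m)) else h x).
  exists b; split=> [|k|k]; first exact: (bP 0).
    by have := bP k.+1; rewrite gt_max => /andP[].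
  by have := bP k.+1; rewrite gt_max => /andP[].
pose om : seqs W := fun x y k => if odd k then rho x k./2 == y
   else let p := dec k./2 in `[< C x p.1 p.2 >].
have omC x y k v : om x y (pickle (k, v)).*2 = C x k v :> Prop.
  by rewrite /om odd_double doubleK decK; apply/propext; split=> /asboolP.
have omR x y k : om x y k.*2.+1 = (rho x k == y).
  by rewrite /om /= odd_double /= uphalf_double.
have [a [a0a Ha ra]] := gP om H a0; exists a.
have pa : exists b, (b < a)%O by exists a0.
split=> // [x xa|]; first by have [hb _ _] := HP x; exact: lt_trans hb (Ha x xa).
have fin_sec k : exists s : seq (seq nat), forall t, pickle t < k -> t \in s.
  exists (pmap unpickle (iota 0 k)) => t tk.
  by rewrite mem_pmap; apply/mapP; exists (pickle t); rewrite ?mem_iota ?pickleK.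
have Ddisc s : D a om s -> exists k, forall m, k <= m -> ~ meets (D a om) (m :: s).
  move=> [s0 _].
  have [u uP] := fin_sec (\max_(k < (colT s).+1) maxn (exc a k om) (idx a k om)).
  have [l lP] := seq_bound (flatten u) id.
  exists l => m lm [t [t0 [k [kt tk]]] mt].
  have tu : t \in u.
    apply: uP; rewrite (colT_suffix s0 (suffix_consW mt)) in kt.
    apply: leq_trans (leq_bigmax (F := fun k : 'I_(colT s).+1 =>
       maxn (exc a k om) (idx a k om)) (Ordinal (kt : k < (colT s).+1))).
    by rewrite leq_max /=; apply/orP.
  have mint : m \in t by case/suffixP: mt => v ->; rewrite mem_cat inE eqxx orbT.
  have /lP : m \in flatten u by apply/flattenP; exists t.
  by rewrite ltnNge lm.
have FE : F a om = leftof (D a om) by rewrite /F; case: pselect.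
rewrite FE in ra.
have [k0 k0P] := not_inf_often (reaps_leftof (pg a) Ddisc ra).
have bdom k : k0 <= k -> exc a k om <= bd a k /\ idx a k om <= bd a k.
  move=> k0k; have [t [gt kt tb]] := bdP a k.
  have nD : ~ D a om t.
    by move=> Dt; apply: (k0P (colT t)); [exact: leq_trans kt|exists t].
  have t0 : t <> [::] by move=> tE; apply: (g0 a); rewrite -tE.
  split; rewrite leqNgt -tb; apply/negP => H'; apply: nD; split=> //; exists k.
    by split=> //; left.
  by split=> //; right.
have [u uP] : exists u : seq (nat * nat), forall p : nat * nat, pickle p < k0 -> p \in u.
  exists (pmap unpickle (iota 0 k0)) => p pk.
  by rewrite mem_pmap; apply/mapP; exists (pickle p); rewrite ?mem_iota ?pickleK.
have [l lP] := seq_bound u fst; exists l => n k ln.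
have k0nk : k0 <= pickle (n, k).
  by rewrite leqNgt; apply/negP => /uP/lP /=; rewrite ltnNge ln.
have [excb idxb] := bdom _ k0nk.
have lada := lad_lt pa n.
split.
  have [_ _ etaa] := HP (lad a n).
  have [x0 x0P] : almost_sub (I a) (C (lad a n) k).
    apply: almost_sub_trans (etaP (lad a n, k)).
    by apply: I_sub; exact: lt_trans (etaa k) (Ha _ lada).
  have [] := @leastP (fun x => forall v, x <= v -> I a v ->
     om (lad a (dec (pickle (n, k))).1) (lad a (dec (pickle (n, k))).1)
        (pickle ((dec (pickle (n, k))).2, v)).*2).
    by exists x0 => v xv Iv; rewrite decK omC; exact: x0P.
  rewrite -/(exc a (pickle (n, k)) om) => excP _.
  have [] := @leastP (fun v => I a v /\ bd a (pickle (n, k)) <= v).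
    by have [v bv Iv] := I_inf a (bd a (pickle (n, k))); exists v.
  rewrite -/(J a n k) => -[IJ bJ] _.
  by have := excP _ (leq_trans excb bJ) IJ; rewrite decK omC.
have [_ rhoa _] := HP (lad a n).
have [_ /(_ (rho (lad a n) k))[]] := eP a pa; first exact: lt_trans (rhoa k) (Ha _ lada).
move=> i ei.
have [] := @leastP (fun i => om (lad a (dec (pickle (n, k))).1) (e a i)
   (dec (pickle (n, k))).2.*2.+1).
  by exists i; rewrite decK omR ei.
rewrite -/(idx a (pickle (n, k)) om) decK omR => /eqP -> _.
by apply/mapP; exists (idx a (pickle (n, k)) om); rewrite ?mem_iota //= add0n ltnS.
Qed.

End Guess.

(** * Gluing embeddings column by column *)

Definition rangeT (e : seq nat -> seq nat) : set (seq nat) :=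
  e @` [set s | s <> [::]].

Definition colsub (A B : set (seq nat)) : Prop :=
  exists k, forall s, k <= colT s -> A s -> B s.

Lemma colsub_trans A B C : colsub A B -> colsub B C -> colsub A C.
Proof.
move=> [k kP] [l lP]; exists (maxn k l) => v; rewrite geq_max => /andP[kv lv] Av.
by apply: lP => //; exact: kP.
Qed.

Section Glue.
Variable jmp : nat -> seq nat -> seq nat.
Hypothesis jmp_suffix : forall n s, suffix s (jmp n s).
Variable lb : nat -> nat.

Fixpoint jtree (n K : nat) (s : seq nat) : seq nat :=
  match s with
  | [::] => [::]
  | m :: s' => jmp n (if s' is [::] then [:: K] else m :: jtree n K s')
  end.

Fixpoint start (E : nat -> seq nat -> seq nat) (n : nat) : nat :=
  least (fun K => [/\ lb n <= K,
    (if n is m.+1 then colT (E m [:: start E m]) < colT (E n [:: K]) else True) &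
    forall t, t <> [::] -> colT t = K -> forall k, k <= n -> exists t', E k t' = E n t]).

Definition glue (E : nat -> seq nat -> seq nat) (s : seq nat) : seq nat :=
  if s is [::] then [::] else E (colT s) (jtree (colT s) (start E (colT s)) s).

Lemma jtree_suffix n K m s : s <> [::] -> suffix (m :: jtree n K s) (jtree n K (m :: s)).
Proof. by case: s => // a s _; exact: jmp_suffix. Qed.

Lemma jtree_col n K s : s <> [::] -> suffix [:: K] (jtree n K s).
Proof.
elim: s => // m [|a s] IH _; first exact: jmp_suffix.
apply: suffix_trans (IH _) _ => //.
by apply: suffix_trans (jtree_suffix _ _ _ _) => //; exact: suffix_suffix [:: _] _.
Qed.

Lemma jtree_jmp n K s : s <> [::] -> exists t, jtree n K s = jmp n t.
Proof. by case: s => // m s _; eexists. Qed.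

Variable E : nat -> seq nat -> seq nat.
Hypothesis E_emb : forall n, emb (E n).
Hypothesis E_sub : forall m n, m <= n -> colsub (rangeT (E n)) (rangeT (E m)).

Let c n := colT (E n [:: start E n]).

Lemma startP n : [/\ lb n <= start E n,
    (if n is m.+1 then c m < c n else True) &
    forall t, t <> [::] -> colT t = start E n ->
      forall k, k <= n -> exists t', E k t' = E n t].
Proof.
suff ex : exists K, [/\ lb n <= K,
    (if n is m.+1 then c m < colT (E n [:: K]) else True) &
    forall t, t <> [::] -> colT t = K -> forall k, k <= n -> exists t', E k t' = E n t].
  by case: n ex => [|n] ex; exact: (leastP ex).1.
have /choice[f fP] : forall k, exists l, k <= n ->
    forall s, l <= colT s -> rangeT (E n) s -> rangeT (E k) s.
  move=> k; have [kn|_] := leqP k n; last by exists 0.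
  by have [l lP] := E_sub kn; exists l.
case: (E_emb n) => e0 [kap [ki _ ek]].
have col t : t <> [::] -> colT (E n t) = kap [::] (colT t).
  move=> t0; have := emb_suffix (E_emb n) (suffix_colT t0).
  have := ek [::] (colT t); rewrite e0 => kc ct.
  by rewrite (@colT_suffix [:: kap [::] (colT t)]) // (suffix_trans kc ct).
pose q := maxn (\max_(k < n.+1) f k) (if n is m.+1 then (c m).+1 else 0).
have [l lP] := inj_unbounded (ki [::]) q.
pose K := maxn l (lb n); exists K.
have qK : q <= kap [::] K by apply: lP; exact: leq_maxl.
split; first exact: leq_maxr.
  move: qK; rewrite /q; case: (n) col => // m col; rewrite geq_max => /andP[_].
  by rewrite col.
move=> t t0 tK k kn.
have [] // : rangeT (E k) (E n t).
  apply: fP => //; last by exists t.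
  rewrite col // tK; apply: leq_trans qK; rewrite leq_max; apply/orP; left.
  exact: (leq_bigmax (F := fun k : 'I_n.+1 => f k) (Ordinal (kn : k < n.+1))).
by move=> t' _ <-; exists t'.
Qed.

Lemma glue_col_homo : {homo c : m n / m < n}.
Proof.
apply: (@homo_ltn _ _ (fun m n => m < n)) => [y x z|n]; first exact: ltn_trans.
by have [_] := startP n.+1.
Qed.

Lemma glue_suffix s : s <> [::] ->
  suffix (E (colT s) [:: start E (colT s)]) (glue E s).
Proof.
case: s => // m s _; apply: emb_suffix => //; exact: jtree_col.
Qed.

Lemma glue_col s : s <> [::] -> colT (glue E s) = c (colT s).
Proof.
move=> s0; apply: colT_suffix (glue_suffix s0); exact: emb_neq0.
Qed.

Lemma glue_emb : emb (glue E).
Proof.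
split=> //.
have /choice[kap kapP] : forall n, exists kap : seq nat -> nat -> nat,
    [/\ forall s, injective (kap s), forall s m, s <> [::] -> odd (kap s m) = odd m &
        forall s m, suffix (kap s m :: E n s) (E n (m :: s))].
  by move=> n; case: (E_emb n) => _ [k kP]; exists k.
have jn0 n K s : s <> [::] -> jtree n K s <> [::].
  by move=> /(jtree_col n K)/size_suffix; case: jtree.
exists (fun s m => if s is [::] then c m else
  kap (colT s) (jtree (colT s) (start E (colT s)) s) m); split.
- case=> [|a s] /=; last by case: (kapP (colT (a :: s))).
  by move=> m n; case: (ltngtP m n) => // /glue_col_homo; move=> + cmn; rewrite cmn ltnn.
- by case=> // a s m _; case: (kapP (colT (a :: s))) => _ -> //; exact: jn0.
- case=> [|a s] m.
    rewrite -[c m]/(c (colT [:: m])) -glue_col //; apply: suffix_colT.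
    by apply: (emb_neq0 (E_emb _)); exact: jn0.
  have ck : colT (m :: a :: s) = colT (a :: s) by [].
  rewrite /glue ck; case: (kapP (colT (a :: s))) => _ _ kP.
  apply: suffix_trans (kP _ _) _; apply: emb_suffix => //; exact: jtree_suffix.
Qed.

Lemma glue_range k s : k <= colT s -> s <> [::] -> rangeT (E k) (glue E s).
Proof.
move=> ks s0; have [_ _ /(_ (jtree (colT s) (start E (colT s)) s))] := startP (colT s).
have jc := jtree_col (colT s) (start E (colT s)) s0.
have jn0 : jtree (colT s) (start E (colT s)) s <> [::].
  by move/size_suffix: jc; case: jtree.
move=> /(_ jn0); rewrite (colT_suffix _ jc) // => /(_ erefl k ks)[t tE].
have gE : glue E s = E (colT s) (jtree (colT s) (start E (colT s)) s) by case: (s) s0.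
exists t; last by rewrite gE.
move=> t0; apply: (emb_neq0 (E_emb (colT s)) jn0).
by rewrite -tE t0; case: (E_emb k).
Qed.

Lemma glue_colsub k (A : set (seq nat)) :
  colsub (rangeT (E k)) A -> colsub (rangeT (glue E)) A.
Proof.
apply: colsub_trans; exists (c k) => _ /[swap] -[s s0 <-].
rewrite glue_col // => ck; apply: glue_range => //.
by rewrite leqNgt; apply/negP => /glue_col_homo; rewrite ltnNge ck.
Qed.

Lemma glue_avoid n0 (A : set (seq nat)) :
  (forall n t, n0 <= n -> jmp n t <> [::] -> lb n <= colT (jmp n t) -> A (E n (jmp n t))) ->
  colsub (rangeT (glue E)) A.
Proof.
move=> nA; exists (c n0) => _ /[swap] -[s s0 <-]; rewrite glue_col // => cs.
have ns : n0 <= colT s by rewrite leqNgt; apply/negP => /glue_col_homo; rewrite ltnNge cs.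
have gE : glue E s = E (colT s) (jtree (colT s) (start E (colT s)) s) by case: (s) s0.
have jc := jtree_col (colT s) (start E (colT s)) s0.
have [t jt] := jtree_jmp (colT s) (start E (colT s)) s0.
rewrite gE jt; apply: nA => //; rewrite -jt.
  by move/size_suffix: jc; case: jtree.
by rewrite (colT_suffix _ jc) //; case: (startP (colT s)).
Qed.

End Glue.

Section TreeTower.
Context {d : Order.disp_t} (W : orderType d).
Hypothesis W1 : is_omega1 W.
Hypothesis dia : diamondT W.

Lemma borf_start a lb (E : seqs W -> nat -> seq nat -> seq nat) n :
  (forall n t, borf a (fun om => E om n t)) ->
  borf a (fun om => start lb (E om) n).
Proof.
move=> bE.
have bl n' (P : seqs W -> nat -> Prop) : (forall K, bor a (fun om => P om K)) ->
    borf a (fun om => least (fun K => [/\ lb n' <= K, P om K &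
      forall t, t <> [::] -> colT t = K -> forall k, k <= n' ->
        exists t', E om k t' = E om n' t])).
  move=> bP; apply: (borf_least (P := fun K om => [/\ lb n' <= K, P om K &
      forall t, t <> [::] -> colT t = K -> forall k, k <= n' ->
        exists t', E om k t' = E om n' t])) => K.
  apply: (@bor_ext _ _ a (fun om => lb n' <= K /\ (P om K /\
      forall t, t <> [::] -> colT t = K -> forall k, k <= n' ->
        exists t', E om k t' = E om n' t))).
    by move=> om; split=> [[? []]|[]].
  apply: bor_and; first exact: bor_cst.
  apply: bor_and => //.
  apply: bor_all => t; apply: bor_imp; first exact: bor_cst.
  apply: bor_imp; first exact: bor_cst.
  apply: bor_all => k; apply: bor_imp; first exact: bor_cst.
  apply: bor_ex => t'.
  by apply: (bor_bind (P := fun v om => E om k t' = v)) => // v; exact: bE.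
elim: n => [|n IH] /=.
  by apply: (bl 0 (fun _ _ => True)) => K; exact: bor_cst.
apply: (borf_bind (g := fun Kn om => least (fun K => [/\ lb n.+1 <= K,
  colT (E om n [:: Kn]) < colT (E om n.+1 [:: K]) &
  forall t, t <> [::] -> colT t = K -> forall k, k <= n.+1 ->
     exists t', E om k t' = E om n.+1 t])) IH) => Kn.
apply: (bl n.+1 (fun om K => colT (E om n [:: Kn]) < colT (E om n.+1 [:: K]))) => K.
apply: (bor_bind (P := fun v om => colT v < colT (E om n.+1 [:: K]))) => // v.
by apply: (bor_bind (P := fun u om => colT v < colT u)) => // u; exact: bor_cst.
Qed.

Lemma borf_glue a jmp lb (E : seqs W -> nat -> seq nat -> seq nat) s :
  (forall n t, borf a (fun om => E om n t)) ->
  borf a (fun om => glue jmp lb (E om) s).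
Proof.
move=> bE; case: s => [|m s]; first exact: borf_cst.
rewrite /glue; set n := colT _.
apply: (borf_bind (g := fun K om => E om n (jtree jmp n K (m :: s)))) => [|K].
  exact: borf_start.
exact: bE.
Qed.

Lemma glue_posT jmp lb (E : nat -> seq nat -> seq nat) (g : set (seq nat)) e (Y : set (seq nat)) :
  emb (glue jmp lb E) -> emb e -> (forall s, s <> [::] -> g (e s)) ->
  ~ posT (g `\` [set s | s <> [::] /\ Y (glue jmp lb E s)]) ->
  ~ posT (rangeT (glue jmp lb E \o e) `\` Y).
Proof.
move=> eg ee ge nW [C pC CY]; apply: nW; exists (glue jmp lb E @^-1` C).
  apply: emb_preimage_perfT => // t /CY[[s _ <-] _]; by exists (e s).
move=> s /= /CY[[u u0 /= /(emb_inj eg) es] nY]; split; first by rewrite -es; exact: ge.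
by case.
Qed.

Lemma thin_trace (X0 : set (seq nat)) (E : seq nat -> seq nat) (Z : set (seq nat)) :
  emb E -> colsub (rangeT E) X0 -> ~ posT (X0 `\` Z) ->
  exists k, forall D, crowdedT D ->
    D `<=` [set s | (s <> [::] /\ ~ Z (E s)) /\ k <= colT s] -> D `<=` set0.
Proof.
move=> eE [k kP] nX.
apply: (@not_posT_thin [set s | s <> [::] /\ ~ Z (E s)]); first by case.
move=> [D pD DZ]; apply: nX.
have [C pC CD] : posT [set s | (E @` D) s /\ k <= colT s].
  by apply: posT_tail; exists (E @` D) => //; exact: emb_image_perfT.
exists C => // s /CD[[t Dt <-] ks]; have [t0 nZ] := DZ _ Dt.
by split=> //; apply: kP => //; exists t.
Qed.

Lemma tree_tower : exists X : W -> set (seq nat),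
  [/\ forall a, perfT (X a), forall a b, (b < a)%O -> colsub (X a) (X b) &
      forall Y, exists a, colsub (X a) Y \/ colsub (X a) (~` Y)].
Proof.
have [a00 _] := omega1_inhabited W1.
have /choice[lad ladP] : forall a, exists l : nat -> W, (exists b, (b < a)%O) ->
    [/\ forall n, (l n < a)%O, {homo l : m n / m <= n >-> (m <= n)%O} &
      forall b, (b < a)%O -> exists n, (b <= l n)%O].
  move=> a; have [pa|npa] := pselect (exists b, (b < a)%O); last by exists (fun=> a00).
  by have [l lP] := ladder W1 pa; exists l.
have lad_lt a : (exists b, (b < a)%O) -> forall n, (lad a n < a)%O by move=> /ladP[].
have lad_homo a : (exists b, (b < a)%O) -> {homo lad a : m n / m <= n >-> (m <= n)%O}.
  by move=> /ladP[].
have lad_cof a : (exists b, (b < a)%O) -> forall b, (b < a)%O -> exists n, (b <= lad a n)%O.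
  by move=> /ladP[].
have [I [I_inf I_sub I_ultra]] := ultra_tower W1 dia lad_lt lad_homo lad_cof.
have wU := tower_free_ultra I_inf I_sub I_ultra.
have [J [B JB]] := guess W1 dia lad_lt I_inf I_sub.
have /choice[jmp' jmp'P] := fun an : W * nat => jump_exists W1
   (fun st => J an.1 an.2 (pickle st).+1) (fun st => B an.1 an.2 (pickle st).+1).
pose jmp a n := jmp' (a, n).
pose lb a n := J a n 0.
have jmpS a n s : suffix s (jmp a n s) by exact: (jmp'P (a, n)).1.
pose Ed (om : seqs W) x (s : seq nat) : seq nat :=
  odflt [::] (unpickle (least (fun v => om x x (pickle (s, v)).*2))).
pose EE a (om : seqs W) := glue (jmp a) (lb a) (fun n => Ed om (lad a n)).
pose F a om : set (seq nat) := if pselect (exists b, (b < a)%O) is left _ then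
  [set s | s <> [::] /\ om (lad a 0) (lad a 0) (pickle (EE a om s)).*2.+1] else set0.
have bF a t : bor a (fun om => F a om t).
  rewrite /F; case: pselect => [pa|_]; last exact: bor_cst.
  apply: bor_and; first exact: bor_cst.
  apply: (bor_bind (P := fun s om => om (lad a 0) (lad a 0) (pickle s).*2.+1)).
    apply: borf_glue => n s.
    apply: (borf_bind (g := fun v om => odflt [::] (unpickle v))).
      by apply: borf_least => v; apply: bor_coord; exact: lad_lt.
    by move=> v; exact: borf_cst.
  by move=> s; apply: bor_coord; exact: lad_lt.
have [g [pg gP]] := dia bF.
have /choice[eg egP] : forall a, exists e, emb e /\ forall s, s <> [::] -> g a (e s).
  move=> a; have [g0 _ gc gu] := pg a.
  by have [e ee eP] := crowded_emb g0 gc gu; exists e.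
pose body a (f : W -> seq nat -> seq nat) : seq nat -> seq nat :=
  if pselect (exists b, (b < a)%O) is left _
  then glue (jmp a) (lb a) (fun n => f (lad a n)) \o eg a else eg a.
have [a f1 f2 f12|E EE'] := wo_rec W1 (F := body) _ id.
  rewrite /body; case: pselect => // pa.
  suff -> : (fun n => f1 (lad a n)) = (fun n => f2 (lad a n)) by [].
  by apply/funext => n; apply: f12; exact: lad_lt.
have tower a : emb (E a) /\ forall b, (b < a)%O -> colsub (rangeT (E a)) (rangeT (E b)).
  elim/(wo_ind W1): a => a IH; rewrite EE' /body; case: pselect => [pa|npa]; last first.
    split; first exact: (egP a).1.
    by move=> b ba; case: npa; exists b.
  have E_emb n : emb (E (lad a n)) by have [] := IH _ (lad_lt _ pa n).
  have E_sub m n : m <= n -> colsub (rangeT (E (lad a n))) (rangeT (E (lad a m))).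
    move=> /(lad_homo _ pa); rewrite le_eqVlt => /orP[/eqP ->|]; first by exists 0.
    by have [_] := IH _ (lad_lt _ pa n); apply.
  have ge := glue_emb (jmpS a) (lb a) E_emb E_sub.
  split; first by apply: emb_comp => //; exact: (egP a).1.
  move=> b ba; have [n bn] := lad_cof _ pa _ ba.
  apply: (@colsub_trans _ (rangeT (glue (jmp a) (lb a) (fun n => E (lad a n))))).
    exists 0 => _ _ [s s0 <-]; exists (eg a s) => //.
    exact: (emb_neq0 (egP a).1 s0).
  apply: (@glue_colsub _ (jmpS a) _ _ E_emb E_sub n).
  move: bn; rewrite le_eqVlt => /orP[/eqP ->|]; first by exists 0.
  by have [_] := IH _ (lad_lt _ pa n); apply.
exists (fun a => rangeT (E a)); split=> [a|a|Y].
- by apply: emb_image_perfT perfT_full; exact: (tower a).1.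
- by case: (tower a).
pose om : seqs W := fun x y k => if odd k
  then `[< exists2 s, Y s & k./2 = pickle s >]
  else `[< exists s : seq nat, k./2 = pickle (s, pickle (E x s)) >].
have omE x (s : seq nat) v : om x x (pickle (s, v)).*2 = (v = pickle (E x s)) :> Prop.
  rewrite /om odd_double doubleK; apply/propext; split.
    by move=> /asboolP[t /(pcan_inj pickleK)[<- ->]].
  by move=> ->; apply/asboolP; exists s.
have omY x s : om x x (pickle s).*2.+1 = Y s :> Prop.
  rewrite /om /= odd_double /= uphalf_double; apply/propext; split.
    by move=> /asboolP[t Yt /(pcan_inj pickleK) ->].
  by move=> Ys; apply/asboolP; exists s.
have EdE x s : Ed om x s = E x s.
  rewrite /Ed; have [] := @leastP (fun v => om x x (pickle (s, v)).*2).
    by exists (pickle (E x s)); rewrite omE.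
  by rewrite omE => -> _; rewrite pickleK.
have [x0 [x0a _ rx0]] := gP om id a00.
have [Z [ZY nZ]] : exists Z : set (seq nat),
    (Z = Y \/ Z = ~` Y) /\ ~ posT (rangeT (E x0) `\` Z).
  have px0 : exists b, (b < x0)%O by exists a00.
  have E_emb n : emb (E (lad x0 n)) by case: (tower (lad x0 n)).
  have E_sub m n : m <= n -> colsub (rangeT (E (lad x0 n))) (rangeT (E (lad x0 m))).
    move=> /(lad_homo _ px0); rewrite le_eqVlt => /orP[/eqP ->|]; first by exists 0.
    by have [_] := tower (lad x0 n); apply.
  have ge := glue_emb (jmpS x0) (lb x0) E_emb E_sub.
  have EEE : EE x0 om = glue (jmp x0) (lb x0) (fun n => E (lad x0 n)).
    by congr glue; apply/funext => n; apply/funext => s; exact: EdE.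
  have FE : F x0 om =
      [set s | s <> [::] /\ Y (glue (jmp x0) (lb x0) (fun n => E (lad x0 n)) s)].
    by rewrite /F; case: pselect => // _; apply/seteqP; split=> s; rewrite /= omY EEE.
  have x0E : E x0 = glue (jmp x0) (lb x0) (fun n => E (lad x0 n)) \o eg x0.
    by rewrite EE' /body; case: pselect.
  rewrite FE in rx0; rewrite x0E; case: rx0 => nr; [exists Y|exists (~` Y)].
    by split; [left|exact: (glue_posT ge (egP x0).1 (egP x0).2 nr)].
  split; first by right.
  apply: (glue_posT ge (egP x0).1 (egP x0).2); apply: contra_not nr.
  apply: posTS => s [gs H]; have s0 : s <> [::].
    by move=> sE; have [g0 _ _ _] := pg x0; apply: g0; rewrite -sE.
  by split=> //; split=> //; apply: contrapT => nY; apply: H.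
suff [x xZ] : exists x, colsub (rangeT (E x)) Z.
  by exists x; case: ZY => <-; [left|right].
have thin x : exists N : set (seq nat), exists k,
    (forall D, crowdedT D -> D `<=` N -> D `<=` set0) /\
    ((x0 <= x)%O -> forall s, s <> [::] -> k <= colT s -> ~ N s -> Z (E x s)).
  have [x0x|_] := leP x0 x; last by exists set0, 0.
  have sub : colsub (rangeT (E x)) (rangeT (E x0)).
    move: x0x; rewrite le_eqVlt => /orP[/eqP ->|]; first by exists 0.
    by have [_] := tower x; apply.
  have [k kP] := thin_trace (tower x).1 sub nZ.
  exists [set s | (s <> [::] /\ ~ Z (E x s)) /\ k <= colT s], k; split=> // _ s s0 ks nN.
  by apply: contrapT => nZs; apply: nN.
have /choice[p pP] : forall x, exists p : nat * (seq nat * nat -> Prop) * (seq nat * nat -> W),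
   exists N : set (seq nat),
   [/\ forall st, p.1.2 st -> (st.2 = 0 -> ~ N st.1) /\ boxT (tower_ultra I) p.1.2 st,
       forall st, p.1.2 st \/ boxT (tower_ultra I) (fun st' => (p.2 st' < p.2 st)%O) st &
       (x0 <= x)%O -> forall s, s <> [::] -> p.1.1 <= colT s -> ~ N s -> Z (E x s)].
  move=> x; have [N [k [Nthin NZ]]] := thin x.
  by have [St [rk [StP rkP]]] := thin_search W1 wU Nthin; exists (k, St, rk), N.
pose C x k : set nat := if k is j.+1 then
    if unpickle j is Some st then [set m |
      ((p x).1.2 st -> (p x).1.2 (step st m)) /\
      (~ (p x).1.2 st -> ((p x).2 (step st m) < (p x).2 st)%O)] else setT
  else [set m | (p x).1.1 <= m].
pose rho x k := if k is j.+1 then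
    if unpickle j is Some st then (p x).2 st else a00 else a00.
have wC x k : tower_ultra I (C x k).
  case: k => [|j] /=; first exact: (ultra_ge wU).
  have [_ wS _ _] := wU.
  case: unpickle => [st|]; last by apply: wS (ultra_ge wU 0).
  have [N [StP rkP _]] := pP x.
  have [Sst|nS] := pselect ((p x).1.2 st).
    by have [_] := StP _ Sst; apply: wS => m Sm; split.
  by have [//|] := rkP st; apply: wS => m rm; split.
have [x [x0x _ [n0 n0P]]] := JB C rho wC id x0.
exists x.
have px : exists b, (b < x)%O by exists x0.
have E_emb n : emb (E (lad x n)) by case: (tower (lad x n)).
have E_sub m n : m <= n -> colsub (rangeT (E (lad x n))) (rangeT (E (lad x m))).
  move=> /(lad_homo _ px); rewrite le_eqVlt => /orP[/eqP ->|]; first by exists 0.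
  by have [_] := tower (lad x n); apply.
apply: (@colsub_trans _ (rangeT (glue (jmp x) (lb x) (fun n => E (lad x n))))).
  rewrite EE' /body; case: pselect => // _.
  exists 0 => _ _ [s s0 <-]; exists (eg x s) => //; exact: (emb_neq0 (egP x).1 s0).
have [n1 n1P] := lad_cof _ px _ x0x.
apply: (@glue_avoid _ (jmpS x) _ _ E_emb E_sub (maxn n0 n1)) => n t.
rewrite geq_max => /andP[n0n n1n] jt0 jtc.
have [N [StP rkP NZ]] := pP (lad x n).
apply: NZ => //.
- by apply: le_trans n1P _; exact: (lad_homo _ px).
- by apply: leq_trans jtc; have [] := n0P n 0 n0n.
have good st : ((p (lad x n)).1.2 st -> (p (lad x n)).1.2 (step st (J x n (pickle st).+1))) /\
   (~ (p (lad x n)).1.2 st ->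
      ((p (lad x n)).2 (step st (J x n (pickle st).+1)) < (p (lad x n)).2 st)%O).
  by have [] := n0P n (pickle st).+1 n0n; rewrite /= pickleK.
apply: ((jmp'P (x, n)).2 N (p (lad x n)).1.2 (p (lad x n)).2) => /= st.
- by move=> Sst; split; [exact: (StP _ Sst).1|exact: (good st).1].
- by have [Sst|nS] := pselect ((p (lad x n)).1.2 st); [left|right; exact: (good st).2].
- by have [_] := n0P n (pickle st).+1 n0n; rewrite /rho pickleK.
Qed.

End TreeTower.

(** * The tree of positive rationals *)

Section RatTree.
Local Open Scope ring_scope.
Implicit Types (x y r q : rat) (A : set rat) (s t : seq nat).

Lemma sqr_neq2 x : x ^+ 2 <> 2%:R.
Proof.
move=> xx; have : (numq x) ^+ 2 = 2 * (denq x) ^+ 2.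
  apply: (@intr_inj rat); rewrite !expr2 !intrM -!expr2.
  by rewrite numqE exprMn xx.
move=> /(congr1 absz); rewrite abszM !abszX => /(congr1 (logn 2)).
rewrite lognM ?expn_gt0 ?absz_gt0 ?denq_neq0 // !lognX /= => /(congr1 odd).
by rewrite oddD !oddM.
Qed.

(* The integer part of [sqrt 2 / r], for positive [r]. *)
Definition fl r : nat := least (fun n => 2%:R < (n.+1%:R * r) ^+ 2).

Lemma flP r k : 0 < r -> (k <= fl r)%N = ((k%:R * r) ^+ 2 < 2%:R).
Proof.
move=> r0.
have mono m n : (m <= n)%N -> (m%:R * r) ^+ 2 <= (n%:R * r) ^+ 2.
  move=> mn; rewrite ler_pXn2r ?nnegrE ?mulr_ge0 ?(ltW r0) //.
  by rewrite ler_pM2r // ler_nat.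
have [|fl1 fl2] := @leastP (fun n => 2%:R < (n.+1%:R * r) ^+ 2).
  have := Num.Theory.archi_boundP (x := 2%:R / r); rewrite divr_ge0 ?(ltW r0) // => /(_ isT).
  set n := Num.bound _ => nb; exists n.
  have : 2%:R < n.+1%:R * r.
    rewrite -ltr_pdivrMr //; apply: lt_le_trans nb _; by rewrite ler_nat.
  by move=> h; nra.
apply/idP/idP.
  case: k => [|k] kf; first by rewrite mul0r expr0n.
  rewrite ltNge le_eqVlt negb_or; apply/andP; split.
    by apply/eqP => /esym /sqr_neq2.
  by apply/negP => /fl2; rewrite leqNgt kf.
move=> kr; rewrite leqNgt; apply/negP => fk.
by have := lt_le_trans (lt_trans kr fl1) (mono _ _ fk); rewrite ltxx.
Qed.

Lemma fl_anti r r' : 0 < r -> r <= r' -> (fl r' <= fl r)%N.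
Proof.
move=> r0 rr'; have r'0 := lt_le_trans r0 rr'; rewrite flP //.
have : (fl r' <= fl r')%N by []. rewrite flP //; apply: le_lt_trans.
by rewrite ler_pXn2r ?nnegrE ?mulr_ge0 ?(ltW r0) ?(ltW r'0) // ler_wpM2l.
Qed.

Lemma fl_ge k : exists2 e : rat, 0 < e & forall r, 0 < r -> r < e -> (k <= fl r)%N.
Proof.
exists (k.+1%:R^-1); first by rewrite invr_gt0.
move=> r r0 re; rewrite flP //.
have k0 : 0 <= k%:R :> rat by [].
have : k.+1%:R * r < 1 by rewrite -ltr_pdivlMl // mulr1.
rewrite -natr1 mulrDl mul1r => h.
have : 0 <= k%:R * r by rewrite mulr_ge0 // ltW.
by move=> h'; nra.
Qed.

Lemma fl_le e : 0 < e -> exists k, forall r, 0 < r -> (k <= fl r)%N -> r < e.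
Proof.
move=> e0; exists (fl e).+1 => r r0 fe; rewrite ltNge; apply/negP => er.
by have := fl_anti e0 er; rewrite leqNgt fe.
Qed.

Lemma fl_locally_constant r : 0 < r ->
  exists2 e : rat, 0 < e & forall r', `|r' - r| < e -> 0 < r' /\ fl r' = fl r.
Proof.
move=> r0; set n := fl r.
have lo : (n%:R * r) ^+ 2 < 2%:R by rewrite -flP.
have hi : 2%:R < (n.+1%:R * r) ^+ 2.
  rewrite ltNge le_eqVlt negb_or; apply/andP; split; first by apply/eqP => /sqr_neq2.
  by rewrite -flP // ltnn.
pose D := Num.min (2%:R - (n%:R * r) ^+ 2) ((n.+1%:R * r) ^+ 2 - 2%:R).
have D0 : 0 < D by rewrite lt_min !subr_gt0 lo.
have m0 : 0 < n.+1%:R :> rat by rewrite ltr0n.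
have c0 : 0 < 3%:R * r * n.+1%:R ^+ 2 by rewrite !mulr_gt0 // exprn_gt0.
exists (Num.min (r / 2%:R) (D / (3%:R * r * n.+1%:R ^+ 2))).
  by rewrite lt_min !divr_gt0.
move=> r'; rewrite lt_min => /andP[r1]; rewrite ltr_pdivlMr // lt_min => /andP[].
move: r1; rewrite ltr_norml => /andP[r1 r2].
have r'0 : 0 < r' by lra.
have nm : n%:R ^+ 2 <= n.+1%:R ^+ 2 :> rat by rewrite ler_pXn2r ?nnegrE // ler_nat.
set m := n.+1%:R in hi m0 c0 nm *; set k := n%:R in lo nm *.
set dl := `|r' - r| => d1 d2.
have dl2 : `|r' ^+ 2 - r ^+ 2| <= dl * (3%:R * r).
  rewrite subr_sqr normrM ler_wpM2l ?normr_ge0 // ger0_norm; lra.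
have small c : c <= m ^+ 2 -> 0 <= c -> `|r' ^+ 2 - r ^+ 2| * c <= dl * (3%:R * r * m ^+ 2).
  move=> cm cge; rewrite mulrA; apply: ler_pM => //; exact: normr_ge0.
have s1 := small _ nm (sqr_ge0 _); have s2 := small _ (lexx _) (sqr_ge0 _).
have a1 := ler_wpM2r (sqr_ge0 k) (ler_norm (r' ^+ 2 - r ^+ 2)).
have a2 := ler_wpM2r (sqr_ge0 m) (ler_norm (- (r' ^+ 2 - r ^+ 2))).
move: a1 a2; rewrite normrN !mulNr !mulrBl => a1 a2.
rewrite !exprMn in lo hi d1 d2.
split=> //; apply/eqP; rewrite eqn_leq; apply/andP; split.
  by rewrite leqNgt flP // -leNgt -/m exprMn ltW //; lra.
by rewrite flP // -/k exprMn; lra.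
Qed.

Lemma fl_surj n : exists2 r, 0 < r & fl r = n.
Proof.
have ex : exists i, (2 * n ^ 2 < i ^ 2)%N.
  by exists (2 * n).+1; rewrite -!mulnn; nia.
case: (ex_minnP ex) => -[//|i] hi imin.
have ilo : (i ^ 2 <= 2 * n ^ 2)%N by rewrite leqNgt; apply/negP => /imin; rewrite ltnn.
have {}ilo : (i.+1 ^ 2 < 2 * n.+1 ^ 2)%N.
  by move: ilo; rewrite -!mulnn; nia.
have i0 : 0 < i.+1%:R :> rat by rewrite ltr0n.
have r0 : 0 < 2%:R / i.+1%:R :> rat by rewrite divr_gt0.
have key k : (k <= fl (2%:R / i.+1%:R))%N = (2 * k ^ 2 < i.+1 ^ 2)%N.
  rewrite flP // mulrA expr_div_n ltr_pdivrMr ?exprn_gt0 // -!natrX -!natrM -natrX ltr_nat.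
  by apply/idP/idP; rewrite -!mulnn; nia.
exists (2%:R / i.+1%:R) => //; apply/eqP; rewrite eqn_leq key hi andbT leqNgt key.
by rewrite -leqNgt ltnW.
Qed.

Definition pt A : rat :=
  odflt 0 (unpickle (least (fun n => exists2 x, A x & pickle x = n))).

Lemma ptP A x : A x -> A (pt A) /\ (pickle (pt A) <= pickle x)%N.
Proof.
move=> Ax; rewrite /pt; have [|[y Ay <-] ymin] :=
    @leastP (fun n => exists2 x, A x & pickle x = n); first by exists (pickle x), x.
by rewrite pickleK; split=> //; apply: ymin; exists x.
Qed.

Definition depth q x : nat := fl `|x - q|.

Definition rad A : nat :=
  least (fun N => forall x, x <> pt A -> (N <= depth (pt A) x)%N -> A x).

(* [cell s] is cut at its first element [q]: the points at distance [r] from [q]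
   go to a child determined by the integer part of [sqrt 2 / r] and by their
   side. No point is lost as [sqrt 2] is irrational. *)
Fixpoint cell s : set rat :=
  if s is m :: s' then [set x | cell s' x /\
    if s' is [::] then m = fl x^-1 else x <> pt (cell s') /\
      m = ((depth (pt (cell s')) x - rad (cell s')).*2 + (pt (cell s') < x)%R)%N]
  else [set x | 0 < x].

Definition node s : rat := pt (cell s).

Lemma cell_gt0 s x : cell s x -> 0 < x.
Proof. by elim: s => // m s IH [/IH]. Qed.

Lemma cell_cons m s x : s <> [::] -> cell (m :: s) x <-> [/\ cell s x, x <> node s &
  m = ((depth (node s) x - rad (cell s)).*2 + (node s < x)%R)%N].
Proof. by case: s => // n s _ /=; split=> [[? []]|[]]. Qed.

Lemma cell_suffix s t x : suffix s t -> cell t x -> cell s x.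
Proof. by move=> /suffixP[u ->]; elim: u => // m u IH [/IH]. Qed.

Lemma cell_open s x : cell s x -> exists2 e : rat, 0 < e & forall y, `|y - x| < e -> cell s y.
Proof.
elim: s x => [|m s IH] x.
  move=> /= x0; exists x => // y; rewrite ltr_norml => /andP[]; lra.
have [-> /= [x0 ->]|s0] := pselect (s = [::]).
  have xV0 : 0 < x^-1 by rewrite invr_gt0.
  have [e e0 eP] := fl_locally_constant xV0.
  pose e' := Num.min (x / 2%:R) (e * (x * (x / 2%:R))).
  exists e'; first by rewrite lt_min !mulr_gt0.
  move=> y; rewrite lt_min => /andP[yx ye].
  have y2 : x / 2%:R < y by move: yx; rewrite ltr_norml => /andP[]; lra.
  have y0 : 0 < y by apply: lt_trans y2; rewrite divr_gt0.
  split=> //; apply/esym; apply: (eP _ _).2.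
  have -> : y^-1 - x^-1 = (x - y) / (x * y) by field; rewrite !gt_eqF.
  rewrite normrM normfV distrC (ger0_norm (ltW (mulr_gt0 _ _))) // ltr_pdivrMr ?mulr_gt0 //.
  by apply: lt_trans ye _; rewrite ltr_pM2l // ltr_pM2l.
move=> /(cell_cons _ _ s0)[sx xn ->].
have [e1 e10 e1P] := IH _ sx.
have xn0 : 0 < `|x - node s| by rewrite normr_gt0 subr_eq0; apply/eqP.
have [e2 e20 e2P] := fl_locally_constant xn0.
exists (Num.min (Num.min e1 e2) `|x - node s|); first by rewrite !lt_min e10 e20.
move=> y; rewrite !lt_min => /andP[/andP[y1 y2] y3].
have [|yn fy] := e2P `|y - node s|.
  apply: le_lt_trans y2; apply: le_trans (ler_dist_dist _ _) _.
  by rewrite opprB addrA subrK.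
apply/(cell_cons _ _ s0); split; first exact: e1P.
  by move=> yE; rewrite yE subrr normr0 ltxx in yn.
rewrite /depth fy; congr (_ + nat_of_bool _)%N; move: y3 yn.
have := ler_norm (y - x); have := ler_norm (- (y - x)); rewrite normrN.
case: (ltrgt0P (x - node s)) xn0 => xs; rewrite ?ltxx // => _ h1 h2 h3 h4.
  have -> : node s < x by lra.
  by apply/esym; lra.
have -> : (node s < x) = false by apply/negbTE; rewrite -leNgt; lra.
by apply/esym/negbTE; rewrite -leNgt; lra.
Qed.

Lemma cell_first s x : cell s x -> cell s (node s) /\
  forall x, x <> node s -> (rad (cell s) <= depth (node s) x)%N -> cell s x.
Proof.
move=> sx; have [sn _] := ptP sx; split=> //.
have [e e0 eP] := cell_open sn; have [k kP] := fl_le e0.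
apply: (@leastP (fun N => forall x, x <> pt (cell s) ->
    (N <= depth (pt (cell s)) x)%N -> cell s x) _).1.
exists k => y yn yk; apply: eP; apply: kP => //.
by rewrite normr_gt0 subr_eq0; apply/eqP.
Qed.

Lemma node_in s : s <> [::] -> cell s (node s) /\
  forall x, x <> node s -> (rad (cell s) <= depth (node s) x)%N -> cell s x.
Proof.
elim: s => // m s IH _.
have [->|s0] := pselect (s = [::]).
  have [r r0 rm] := fl_surj m.
  by apply: (@cell_first _ r^-1); rewrite /= invr_gt0 invrK.
have [_ sP] := IH s0; have [r r0 rm] := fl_surj (rad (cell s) + m./2)%N.
pose x := node s + (if odd m then r else - r).
have dx : depth (node s) x = (rad (cell s) + m./2)%N.
  by rewrite /depth /x addrC addKr -rm; case: odd; rewrite ?normrN ger0_norm // ltW.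
have xn : x <> node s by rewrite /x; case: odd; lra.
apply: (@cell_first _ x); apply/(cell_cons _ _ s0); split=> //.
  by apply: sP => //; rewrite dx leq_addr.
rewrite dx addKn -[LHS]odd_double_half addnC; congr (_ + nat_of_bool _)%N.
by rewrite /x; case: odd; rewrite ltrDl ?r0 // oppr_gt0 ltNge ltW.
Qed.

Lemma node_gt0 s : s <> [::] -> 0 < node s.
Proof. by move=> /node_in[/cell_gt0]. Qed.

Lemma cell_near s e : s <> [::] -> 0 < e -> exists k, forall m x, (k <= m)%N ->
  cell (m :: s) x -> `|x - node s| < e /\ (node s < x) = odd m.
Proof.
move=> s0 e0; have [k kP] := fl_le e0.
exists (k.*2.+2)%N => m x km /(cell_cons _ _ s0)[_ xn mE]; split.
  apply: kP; first by rewrite normr_gt0 subr_eq0; apply/eqP.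
  rewrite -/(depth _ _); move: mE km; case: (node s < x); lia.
by rewrite mE oddD odd_double; case: (node s < x).
Qed.

Lemma cell_far s k : s <> [::] -> exists2 e, 0 < e & forall x, x <> node s ->
  `|x - node s| < e -> exists2 m, (k <= m)%N & cell (m :: s) x.
Proof.
move=> s0; have [e e0 eP] := fl_ge (rad (cell s) + k)%N.
have [_ radP] := node_in s0.
exists e => // x xn xe.
have xn0 : 0 < `|x - node s| by rewrite normr_gt0 subr_eq0; apply/eqP.
have := eP _ xn0 xe; rewrite -/(depth _ _) => dx.
eexists; last by apply/(cell_cons _ _ s0); split=> //; apply: radP => //; lia.
by lia.
Qed.

Lemma cell_node s t : s <> [::] -> t <> [::] -> cell s (node t) <-> suffix s t.
Proof.
move=> s0 t0; split=> [st|st]; last by apply: cell_suffix st (node_in t0).1.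
apply: contrapT => /negP/not_suffix[i /cell_suffix/(_ st)|r i j ij].
  by move=> /(cell_cons _ _ t0)[].
move=> /cell_suffix/(_ st) ri /cell_suffix/(_ (node_in t0).1) rj; apply: ij.
have [r0|r0] := pselect (r = [::]).
  by move: ri rj; rewrite r0 => -[_ ->] [_ ->].
by move: ri rj => /(cell_cons _ _ r0)[_ _ ->] /(cell_cons _ _ r0)[_ _ ->].
Qed.

Lemma node_inj s t : s <> [::] -> t <> [::] -> node s = node t -> s = t.
Proof.
move=> s0 t0 st; apply: suffix_anti; apply/cell_node => //.
  by rewrite -st; exact: (node_in s0).1.
by rewrite st; exact: (node_in t0).1.
Qed.

Lemma node_surj x : 0 < x -> exists2 s, s <> [::] & node s = x.
Proof.
move=> x0; apply: contrapT => nx.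
have /choice[c cP] : forall s, exists m, s <> [::] -> cell s x -> cell (m :: s) x.
  move=> s; exists ((depth (node s) x - rad (cell s)).*2 + (node s < x)%R)%N => s0 sx.
  by apply/(cell_cons _ _ s0); split=> // xn; apply: nx; exists s.
pose f n := iter n (fun s => c s :: s) [:: fl x^-1].
have f0 n : f n <> [::] by case: n.
have fx n : cell (f n) x by elim: n => // n IH; apply: cP.
have pf n : (n <= pickle (node (f n)))%N.
  elim: n => // n IH; apply: leq_ltn_trans IH _.
  have := (node_in (f0 n.+1)).1 => /(cell_cons (c (f n)) _ (f0 n))[sn nn _].
  rewrite ltn_neqAle (ptP sn).2 andbT; apply/eqP => /(pcan_inj (@pickleK _)) /esym.
  exact: nn.
have := leq_trans (pf (pickle x).+1) (ptP (fx _)).2.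
by rewrite ltnn.
Qed.

Lemma cell_col_gt M : exists k, forall n x, (k <= n)%N -> cell [:: n] x -> M < x.
Proof.
have e0 : 0 < (`|M| + 1)^-1 by rewrite invr_gt0 ltr_wpDl.
have [k kP] := fl_le e0; exists k => n x kn [/= x0 nE].
have := kP x^-1; rewrite invr_gt0 -nE => /(_ x0 kn).
rewrite ltf_pV2 ?posrE // ?ltr_wpDl // => Mx.
by apply: le_lt_trans (ler_norm M) _; lra.
Qed.

Lemma cell_col_far k : exists2 M, 0 < M &
  forall x, M < x -> exists2 n, (k <= n)%N & cell [:: n] x.
Proof.
have [e e0 eP] := fl_ge k; exists e^-1; first by rewrite invr_gt0.
move=> x ex; have x0 : 0 < x by apply: lt_trans ex; rewrite invr_gt0.
exists (fl x^-1) => //; apply: eP; first by rewrite invr_gt0.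
by rewrite -[e]invrK ltf_pV2 // posrE invr_gt0.
Qed.

End RatTree.

(** * Perfect sets of positive rationals *)

Section Transfer.
Local Open Scope ring_scope.

Lemma rat_nbhsP (x : rat) (A : set rat) :
  nbhs x A <-> exists2 e : rat, 0 < e & forall y, `|y - x| < e -> A y.
Proof.
split=> [/nbhs_ballP[e /= e0 eA]|[e e0 eA]].
  by exists e => // y; rewrite distrC => yx; exact: eA.
by apply/nbhs_ballP; exists e => // y; rewrite /ball /= distrC => /eA.
Qed.

Lemma rat_closedP (A : set rat) : closed A <->
  forall x, ~ A x -> exists2 e : rat, 0 < e & forall y, A y -> e <= `|y - x|.
Proof.
rewrite -openC openE; split=> [cA x nAx|cA x nAx].
  have /rat_nbhsP[e e0 eP] := cA x nAx; exists e => // y Ay.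
  by rewrite leNgt; apply/negP => /eP.
have [e e0 eP] := cA x nAx; apply/rat_nbhsP; exists e => // y yx Ay.
by have := eP y Ay; rewrite leNgt yx.
Qed.

Lemma ratp_gt0 (x : ratp) : 0 < val x.
Proof. by case: x => x /= /set_mem. Qed.

Lemma ratp_closedP (A : set ratp) : closed A <->
  forall x, ~ A x -> exists2 e : rat, 0 < e & forall y, A y -> e <= `|val y - val x|.
Proof.
rewrite -openC; split=> [[U oU UA] x nAx|cA].
  have : U (val x) by rewrite -[U _]/((set_val @^-1` U) x) UA.
  move: oU; rewrite openE => /[apply] /rat_nbhsP[e e0 eU]; exists e => // y Ay.
  rewrite leNgt; apply/negP => /eU; rewrite -[U _]/((set_val @^-1` U) y) UA.
  exact.
exists [set x | exists2 e : rat, 0 < e & forall y, A y -> e <= `|val y - x|].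
  rewrite openE => x [e e0 eA]; apply/rat_nbhsP; exists (e / 2%:R).
    by rewrite divr_gt0.
  move=> y yx; exists (e / 2%:R) => [|z Az]; first by rewrite divr_gt0.
  have := eA z Az; have := ler_distD y (val z) x; lra.
apply/seteqP; split=> x; last exact: cA.
by move=> [e e0 eA] /eA; rewrite subrr normr0 leNgt e0.
Qed.

Lemma one_gt0 : 1 \in [set q : rat | 0 < q].
Proof. exact/mem_set/ltr01. Qed.

Definition point_of (s : seq nat) : ratp := insubd (exist _ 1 one_gt0 : ratp) (node s).

Lemma val_point s : s <> [::] -> val (point_of s) = node s.
Proof. by move=> s0; rewrite insubdK //; apply/mem_set/node_gt0. Qed.

Lemma point_inj s t : s <> [::] -> t <> [::] -> point_of s = point_of t -> s = t.
Proof.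
by move=> s0 t0 /(congr1 val); rewrite !val_point //; exact: node_inj.
Qed.

Lemma point_surj x : exists2 s, s <> [::] & point_of s = x.
Proof.
have [s s0 sx] := node_surj (ratp_gt0 x); exists s => //.
by apply: val_inj; rewrite val_point.
Qed.

Definition pull (g : set ratp) : set (seq nat) := [set s | s <> [::] /\ g (point_of s)].

Lemma meets_pull (g : set ratp) s : s <> [::] ->
  meets (pull g) s <-> exists2 x, g x & cell s (val x).
Proof.
move=> s0; split=> [[t [t0 gt] st]|[x gx]].
  by exists (point_of t) => //; rewrite val_point //; apply/cell_node.
have [t t0 tx] := point_surj x; rewrite -tx val_point // => /cell_node-/(_ s0 t0) st.
by exists t => //; split=> //; rewrite tx.
Qed.

Lemma scrB_pull (g : set ratp) : scrB g -> perfT (pull g).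
Proof.
move=> [[/ratp_closedP gcl gcr] gu]; split.
- by case.
- move=> s s0 ns; have [e e0 eP] := gcl (point_of s) (fun gs => ns (conj s0 gs)).
  have [k kP] := cell_near s0 e0; exists k => m km /meets_pull[] // x gx /(kP _ _ km)[xe _].
  by have := eP x gx; rewrite val_point // leNgt xe.
- move=> s [s0 gs] b k; have [e e0 eP] := cell_far k s0; have [l lP] := cell_near s0 ltr01.
  have [e' e'0 e'P] := cell_far (maxn k l) s0.
  have [y [z [gy gz]]] := gcr _ gs e' e'0; rewrite val_point // => -[y1 y2 z1 z2].
  have [x [gx xn xe xb]] : exists x, [/\ g x, val x <> node s, `|val x - node s| < e' &
      (node s < val x) = b].
    case: b; [exists z|exists y]; split=> //; try lra.
    - by rewrite gtr0_norm; lra.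
    - by rewrite ltr0_norm; lra.
  have [m + mx] := e'P _ xn xe; rewrite geq_max => /andP[km lm].
  exists m => //; split; first by rewrite -(lP _ _ lm mx).2 xb.
  by apply/meets_pull => //; exists x.
- move=> k; have [M M0 MP] := cell_col_far k; have [x gx /MP[n kn nx]] := gu M.
  by exists n => //; apply/meets_pull => //; exists x.
Qed.

Lemma perfT_image (C : set (seq nat)) : perfT C -> scrB (point_of @` C).
Proof.
move=> [C0 Ccl Ccr Cu].
have Cn s : C s -> s <> [::] by move=> Cs sE; rewrite sE in Cs.
have near_C s (e : rat) : s <> [::] -> 0 < e -> exists k, forall m, (k <= m)%N ->
   meets C (m :: s) -> exists2 x, (point_of @` C) x &
     [/\ `|val x - node s| < e, val x <> node s & (node s < val x) = odd m].
  move=> s0 e0; have [k kP] := cell_near s0 e0; exists k => m' km [t Ct mt].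
  exists (point_of t); first by exists t.
  have t0 := Cn t Ct; rewrite val_point //.
  have mc : cell (m' :: s) (node t) by apply/cell_node.
  have [ct ->] := kP _ _ km mc; split=> //.
  by case/(cell_cons _ _ s0): mc.
split; first split.
- apply/ratp_closedP => x; have [s s0 <-] := point_surj x => ns.
  have nCs : ~ C s by move=> Cs; apply: ns; exists s.
  have [k kP] := Ccl s s0 nCs; have [e e0 eP] := cell_far k s0.
  exists e => // _ [t Ct <-]; have t0 := Cn t Ct; rewrite !val_point // leNgt.
  apply/negP => /eP[|m km mt].
    by move=> /(node_inj t0 s0) ts; apply: nCs; rewrite -ts.
  by apply: (kP m km); exists t => //; apply/cell_node.
- move=> _ [s Cs <-] e e0; have s0 := Cn s Cs; rewrite val_point //.
  have [k kP] := near_C s e s0 e0.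
  have [i ki [oi mi]] := Ccr s Cs false k; have [j kj [oj mj]] := Ccr s Cs true k.
  have [y Cy [ye ys yo]] := kP i ki mi; have [z Cz [ze _ zo]] := kP j kj mj.
  exists y, z; move: ye ze; rewrite !ltr_norml => /andP[y1 y2] /andP[z1 z2].
  have zs : node s < val z by rewrite zo oj.
  split=> //; split; try lra.
  by rewrite lt_neqAle leNgt yo oi andbT; apply/eqP.
- move=> M; have [k kP] := cell_col_gt M; have [n kn [t Ct nt]] := Cu k.
  have t0 := Cn t Ct; exists (point_of t); first by exists t.
  by rewrite val_point //; apply: kP kn _; apply/cell_node.
Qed.

Lemma reaps_pull (g : set ratp) (A : set (seq nat)) : ~ A [::] ->
  reaps g (point_of @` A) -> reapsT (pull g) A.
Proof.
move=> A0.
have An s : s <> [::] -> (point_of @` A) (point_of s) -> A s.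
  move=> s0 [t At /point_inj ts]; rewrite -ts // => tE; by rewrite tE in At.
case=> nr; [left|right] => -[C pC CA]; apply: nr; exists (point_of @` C);
  try exact: perfT_image.
- move=> _ [s /CA[[s0 gs] nAs] <-]; split=> // As; exact: nAs (An _ s0 As).
- move=> _ [s /CA[[s0 gs] As] <-]; split=> //; by exists s.
Qed.

End Transfer.

(** * Borel coding of sequences of reals *)

Definition cylinder (I : Type) (l : seq (I * bool)) : set {ptws I -> bool} :=
  [set A | forall p, List.In p l -> A p.1 = p.2].

Lemma ptws_cylinder (I : choiceType) (x : {ptws I -> bool}) (U : set {ptws I -> bool}) :
  open U -> U x -> exists l, cylinder l x /\ cylinder l `<=` U.
Proof.
move=> oU Ux.
pose G : set_system {ptws I -> bool} :=
  [set V | exists l, cylinder l x /\ cylinder l `<=` V].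
have FG : Filter G.
  split.
  - by exists [::]; split.
  - move=> V1 V2 [l1 [xl1 lV1]] [l2 [xl2 lV2]]; exists (l1 ++ l2); split.
      by move=> p /List.in_app_iff[/xl1|/xl2].
    by move=> A Al; split; [apply: lV1|apply: lV2] => p pl; apply: Al;
       apply/List.in_app_iff; [left|right].
  - by move=> V1 V2 V12 [l [xl lV]]; exists l; split=> //; exact: subset_trans V12.
suff GU : {ptws, G --> x} by apply: GU; exact: open_nbhs_nbhs.
apply/cvg_sup => i; apply/cvg_image.
  apply/seteqP; split=> // b _; exists (fun=> b) => //.
move=> V /nbhs_singleton Vx.
exists [set A : {ptws I -> bool} | V (A i)]; last first.
  apply/seteqP; split=> [_ [A VA <-] //|b Vb]; by exists (fun=> b).
exists [:: (i, x i)]; split; first by move=> p [<-|].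
move=> A /(_ (i, x i)) /= Ai; rewrite Ai //; by left.
Qed.

Lemma ptws_open_coord (I : Type) (i : I) : open [set A : {ptws I -> bool} | A i].
Proof.
rewrite openE => A Ai.
apply: (@proj_continuous {classic I} (fun=> bool) i A [set b : bool | b]).
by apply: open_nbhs_nbhs; split=> //; exact: discrete_open.
Qed.

Lemma borel_bigcup (T : topologicalType) (E : nat -> set T) :
  (forall n, <<s open >> (E n)) -> <<s open >> (\bigcup_n E n).
Proof. by case: (smallest_sigma_algebra (setT : set T) open) => _ _; apply. Qed.

Lemma borelC (T : topologicalType) (E : set T) :
  <<s open >> E -> <<s open >> (~` E).
Proof.
by case: (smallest_sigma_algebra (setT : set T) open) => _ + _ => h /h; rewrite setTD.
Qed.

Lemma borel_cst (T : topologicalType) (P : Prop) : <<s @open T >> [set _ | P].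
Proof.
apply: sub_sigma_algebra; have [p|np] := pselect P.
  by rewrite (_ : [set _ | P] = setT); [exact: openT|apply/seteqP; split].
by rewrite (_ : [set _ | P] = set0); [exact: open0|apply/seteqP; split=> // x /np].
Qed.

Lemma borel_coords (T : topologicalType) (G : T -> set ratp) :
  (forall x, <<s open >> [set s | G s x]) ->
  borel_fun (fun s => indic_bool (G s)).
Proof.
move=> bG.
have bI (p : ratp * bool) : <<s open >> [set s | indic_bool (G s) p.1 = p.2].
  case: p => x [] /=.
    by rewrite (_ : [set _ | _] = [set s | G s x]) //; apply/seteqP; split=> s;
      [move/set_mem|move/mem_set].
  rewrite (_ : [set _ | _] = ~` [set s | G s x]); first exact: borelC.
  apply/seteqP; split=> s; rewrite /= /indic_bool; first by move=> /negbT/negP nG /mem_set.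
  by move=> nG; apply/negbTE/negP => /set_mem.
have bcyl l : <<s open >> [set s | cylinder l (indic_bool (G s))].
  elim: l => [|p l IH].
    by rewrite (_ : [set _ | _] = [set _ | True]); [exact: borel_cst|apply/seteqP; split=> // s _ p []].
  pose E n := if n is 0 then ~` [set s | indic_bool (G s) p.1 = p.2]
    else ~` [set s | cylinder l (indic_bool (G s))].
  rewrite (_ : [set _ | _] = ~` (\bigcup_n E n)).
    by apply: borelC; apply: borel_bigcup => -[|n]; exact: borelC.
  apply/seteqP; split=> s h.
    move=> [[|n] _]; apply; first by apply: h; left.
    by move=> q ql; apply: h; right.
  move=> q [<-|ql]; first by apply: contrapT => nq; apply: h; exists 0.
  by apply: contrapT => nq; apply: h; exists 1 => // /(_ q ql).
have bO U : open U -> <<s open >> [set s | U (indic_bool (G s))].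
  move=> oU.
  pose L n : seq (ratp * bool) :=
    if unpickle n is Some l then [seq (point_of p.1, p.2) | p <- l] else [::].
  pose E n := if pselect (cylinder (L n) `<=` U) is left _
    then [set s | cylinder (L n) (indic_bool (G s))] else [set _ | False].
  rewrite (_ : [set _ | _] = \bigcup_n E n).
    apply: borel_bigcup => n; rewrite /E; case: pselect => _ //; exact: borel_cst.
  apply/seteqP; split=> s; last by move=> [n _]; rewrite /E; case: pselect => // nU /nU.
  move=> /(ptws_cylinder oU)[l [sl lU]].
  have /choice[f fP] : forall x, exists s, point_of s = x.
    by move=> x; have [t _ <-] := point_surj x; exists t.
  pose n := pickle [seq (f p.1, p.2) | p <- l].
  have Ln : L n = l.
    rewrite /L pickleK -map_comp -[RHS]map_id; apply: eq_map => -[x b] /=.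
    by rewrite fP.
  by exists n => //; rewrite /E Ln; case: pselect.
move=> B sB.
apply: (sB [set B : set {ptws ratp -> bool} | <<s open >> [set s | B (indic_bool (G s))]]).
split=> //; split.
- exact: borel_cst.
- move=> V bV; rewrite setTD; exact: borelC bV.
- move=> E bE.
  rewrite /= (_ : [set _ | _] = \bigcup_n [set s | E n (indic_bool (G s))]) //.
  exact: borel_bigcup.
Qed.

Section Coding.
Context {d : Order.disp_t} (W : orderType d).
Hypothesis W1 : is_omega1 W.

Lemma diamond_tree : diamond_rP W -> diamondT W.
Proof.
move=> dia F bF; have [code [code_inj [hc hcP]]] := omega1_code W1.
pose dec a (s : pred_of a -> bool) : seqs W := fun x y k =>
  if pselect (code x y k < a)%O is left ca then s (exist (fun b => (b < a)%O) _ ca) else false.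
pose G a (s : pred_of a -> bool) : set ratp :=
  point_of @` [set t | t <> [::] /\ F a (dec a s) t].
have bor_dec a P : bor a P -> <<s open >> [set s : {ptws pred_of a -> bool} | P (dec a s)].
  elim=> {P} [x y k xa ya|P|P _ IH|P _ IH].
  - rewrite /dec; case: pselect => ca; last exact: borel_cst.
    by apply: sub_sigma_algebra; exact: ptws_open_coord.
  - exact: borel_cst.
  - exact: borelC IH.
  - rewrite (_ : [set _ | _] = \bigcup_n [set s | P n (dec a s)]).
      exact: borel_bigcup.
    by apply/seteqP; split=> s [n]; exists n.
have bG : borel_on_levels G.
  move=> a; apply: borel_coords => x; have [t t0 <-] := point_surj x.
  rewrite (_ : [set _ | _] = [set s | F a (dec a s) t]); first exact: bor_dec (bF a t).
  apply/seteqP; split=> s; last by move=> h; exists t.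
  by move=> [t' [t'0 h] /(point_inj t'0 t0) <-].
have [g [gB gP]] := dia G bG.
exists (fun a => pull (g a)); split=> [a|om h a0]; first exact: scrB_pull.
pose f c := `[< exists x y k, c = code x y k /\ om x y k >].
pose h' b := Order.max (h b) (hc b).
have [a [ra [a0a ha]]] := gP f _ (closure_club W1 h' a0).
have hh x : (x < a)%O -> (h x < a)%O /\ (hc x < a)%O.
  by move=> /ha; rewrite /h' gt_max => /andP[].
exists a; split=> [//|x /hh[]//|].
have decE P : bor a P -> P (dec a (restr f a)) <-> P om.
  elim=> {P} [x y k xa ya|P|P _ IH|P _ IH].
  - have ca : (code x y k < a)%O by apply: hcP => // z /hh[].
    rewrite /dec; case: pselect => // {}ca; rewrite /restr /f /=.
    split=> [/asboolP[x' [y' [k' []]]] /code_inj[-> -> ->] //|oxyk].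
    by apply/asboolP; exists x, y, k.
  - by [].
  - by rewrite IH.
  - by split=> -[n /IH]; exists n.
have FE : [set t | t <> [::] /\ F a (dec a (restr f a)) t] =
    [set t | t <> [::] /\ F a om t].
  by apply/seteqP; split=> t [t0 /(decE _ (bF a t))].
have rT : reapsT (pull (g a)) [set t | t <> [::] /\ F a om t].
  by apply: reaps_pull => [[]//|]; rewrite -FE.
case: rT => nr; [left|right]; apply: contra_not nr; apply: posTS => t [[t0 gt] Ft].
  by split=> // -[_ /Ft].
by split.
Qed.
End Coding.

(** * The ultrafilter *)

Section Gruff.
Local Open Scope ring_scope.

Lemma perfT_perfect (C : set (seq nat)) : perfT C ->
  (forall s, C s -> (1 <= colT s)%N) -> perfect (node @` C).
Proof.
move=> pC C1; have [C0 _ _ _] := pC.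
have Cn s : C s -> s <> [::] by move=> Cs sE; rewrite sE in Cs.
have [[/ratp_closedP Ccl Ccr] _] := perfT_image pC.
have imE x : (point_of @` C) x <-> (node @` C) (val x).
  split=> [[s Cs <-]|[s Cs sx]]; exists s => //; first by rewrite val_point //; exact: Cn.
  by apply: val_inj; rewrite val_point //; exact: Cn.
split.
  apply/rat_closedP => x nx; have [x0|x0] := ltP 0 x.
    have [s s0 sx] := node_surj x0; rewrite -sx -val_point // in nx *.
    have [e e0 eP] := Ccl (point_of s) (fun h => nx ((imE _).1 h)).
    exists e => // _ [t Ct <-]; have t0 := Cn t Ct; rewrite -(val_point t0).
    by apply: eP; exists t.
  exists (1 / 2%:R); first by rewrite divr_gt0.
  move=> _ [t Ct <-]; have t0 := Cn t Ct.
  have [y0 cE] : cell [:: colT t] (node t) by apply/cell_node => //; exact: suffix_colT.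
  have := C1 t Ct; rewrite cE flP ?invr_gt0 // mul1r => h.
  suff : 1 / 2%:R <= node t by move=> h'; apply: le_trans (ler_norm _); lra.
  rewrite leNgt; apply/negP => y1.
  have y2 : 2%:R < (node t)^-1.
    by rewrite -[2%:R]invrK ltf_pV2 ?posrE // -div1r.
  by nra.
apply/seteqP; split=> // x [/set_mem[s Cs <-] [V /rat_nbhsP[e e0 eV] VC]].
have s0 := Cn s Cs.
have [|y [z [Cy _]]] := Ccr (point_of s) _ e e0; first by exists s.
rewrite val_point // => -[y1 y2 _ _].
have : [set node s] (val y).
  rewrite -VC; split; last exact/imE.
  by apply: eV; rewrite ltr0_norm; lra.
by move=> ys; move: y2; rewrite [val y]ys ltxx.
Qed.

End Gruff.

Theorem theorem2p4 (d : Order.disp_t) (W : orderType d) (W1 : is_omega1 W) :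
  diamond_rP W -> exists u : set_system rat, gruff u.
Proof.
move=> /(diamond_tree W1)/(tree_tower W1)[X [pX sX dX]].
pose u : set_system rat := [set A | exists a, colsub (X a) [set s | A (node s)]].
have Xn a s : X a s -> s <> [::] by have [n0 _ _ _] := pX a => Xs sE; rewrite sE in Xs.
have Xle a b : (b <= a)%O -> colsub (X a) (X b).
  by rewrite le_eqVlt => /orP[/eqP ->|/sX //]; exists 0.
have large a k : exists2 s, X a s & k <= colT s.
  have [_ _ _ Xu] := pX a; have [n kn [s Xs ns]] := Xu k.
  by exists s => //; rewrite (colT_suffix _ ns).
have uS A B : A `<=` B -> u A -> u B.
  by move=> AB [a [k kP]]; exists a, k => s ks /(kP _ ks) /AB.
have u0 : ~ u set0 by move=> [a [k kP]]; have [s Xs ks] := large a k; exact: kP ks Xs.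
have uI A B : u A -> u B -> u (A `&` B).
  move=> [a aA] [b bB].
  have [c ca cb] : exists2 c, (a <= c)%O & (b <= c)%O.
    by exists (Order.max a b); rewrite le_max lexx ?orbT.
  have [k kP] := colsub_trans (Xle _ _ ca) aA; have [l lP] := colsub_trans (Xle _ _ cb) bB.
  exists c, (maxn k l) => s; rewrite geq_max => /andP[ks ls] Xs.
  by split; [exact: kP|exact: lP].
have uT : u setT.
  have [a _] := omega1_inhabited W1; by exists a, 0.
have uF : ProperFilter u by do 2?split => //.
have uC A : u A \/ u (~` A).
  have [a [aA|aA]] := dX [set s | A (node s)]; [left|right]; by exists a.
exists u; split.
- apply: Build_UltraFilter => G GF uG; apply/seteqP; split=> // A GA.
  have [//|/uG GnA] := uC A; have [Gn0 _] := GF; case: Gn0.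
  by rewrite -(setICr A); exact: filterI.
- move=> x ux; have [a [k kP]] : u [set x] by rewrite ux.
  have [s Xs ks] := large a k; have [t Xt tk] := large a (colT s).+1.
  have kt : k <= colT t by apply: leq_trans tk; apply: leq_trans (leqnSn _).
  have st : s = t.
    apply: node_inj; [exact: Xn Xs|exact: Xn Xt|].
    by rewrite (kP s ks Xs) (kP t kt Xt).
  by rewrite st ltnn in tk.
- move=> A [a [k kP]].
  pose C : set (seq nat) := [set s | X a s /\ maxn k 1 <= colT s].
  have pC : perfT C.
    apply: (perfT_cols (P := fun n => maxn k 1 <= n)) => //.
    by apply: inf_often_ge; case: (pX a).
  exists (node @` C); split.
  + by exists a, (maxn k 1) => s ks Xs; exists s.
  + apply: (perfT_perfect pC) => s [_]; rewrite geq_max => /andP[//].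
  + by move=> _ [s [Xs +] <-]; rewrite geq_max => /andP[ks _]; exact: kP.
Qed.
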